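(* Let $q\ge2$. If $K$ is a $q$-periodic virtual knot diagram which represents an almost classical knot, then $\bar K=P_f^\infty(K)$, the image of $K$ under stable Manturov projection with respect to the total Gaussian parity $f$, is a $q$-periodic almost classical diagram representing the same virtual knot as $K$.
   Context: A virtual knot diagram is an immersed oriented circle in the plane with transverse double points marked classical (with over/under information) or virtual. Two diagrams represent the same virtual knot if they are related by planar isotopies, classical Reidemeister moves and detour moves (an arc all of whose crossings are virtual may be replaced by any other arc with the same endpoints, all of whose new crossings are virtual). A diagram is $q$-periodic if it misses the origin and is invariant under rotation of the plane by $2\pi/q$ about the origin. The Gauss diagram of a virtual knot diagram is a counterclockwise oriented circle with one directed signed chord for each classical crossing, joining the two preimages of the crossing, pointing from the over-crossing point to the under-crossing point, with sign $\varepsilon=\pm1$ equal to the sign of the crossing. The index of a chord $c$ is $I(c)=r_+-r_-+\ell_--\ell_+$, where, with the diagram positioned so that $c$ points vertically upward, $r_\pm$ (resp. $\ell_\pm$) is the number of chords of sign $\pm1$ that intersect $c$ and have their arrowhead to the right (resp. left) of $c$. The total Gaussian parity is $f(c)=0$ (even) if $I(c)=0$ and $f(c)=1$ (odd) if $I(c)\ne0$. Manturov projection $P_f$ removes all odd chords from the Gauss diagram; on the level of virtual knot diagrams, it replaces every odd classical crossing by a virtual crossing. For each diagram $D$ there is $n$ with $P_f^{n+1}(D)=P_f^n(D)$; $P_f^\infty(D)$ denotes this stable diagram $P_f^n(D)$. A virtual knot diagram is almost classical if it admits an Alexander numbering, i.e. an integer-valued function on its short arcs (arcs between consecutive classical crossing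 points) such that at each classical crossing, drawn with both strands oriented downwards, the two left-hand arcs have a common number $\lambda$ and the two right-hand arcs have number $\lambda+1$ (numbers are unchanged through virtual crossings). Equivalently, every chord of its Gauss diagram has index $0$. A virtual knot is almost classical if it is represented by some almost classical diagram. *)

(* Defs.v *)
From HB Require Import structures.
From mathcomp Require Import all_boot all_order all_algebra finmap.
From mathcomp Require Import all_classical all_reals all_analysis.
Set Implicit Arguments.
Unset Strict Implicit.
Unset Printing Implicit Defensive.
Import Order.TTheory GRing.Theory Num.Theory.
Import numFieldNormedType.Exports.
Local Open Scope classical_set_scope.
Local Open Scope ring_scope.

(** * Virtual knot diagrams

    The circle is R/Z.  An oriented immersed circle is a 1-periodic regular C^1
    curve R -> R^2.  A classical crossing is recorded as the pair (over, under)
    of its two parameters in [0,1[; every double point that is not recorded is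
    a virtual crossing. *)

Section Diagrams.
Context {R : realType}.
Implicit Types (u v p : R * R) (r s t a b : R).

Definition det2 u v : R := u.1 * v.2 - u.2 * v.1.

(* representative in [0,1[ of the class of t in R/Z *)
Definition frac t : R := t - (Num.floor t)%:~R.

Record is_diagram (c : R -> R * R) (X : {fset R * R}) : Prop := IsDiagram {
  curve_periodic : forall t, c (t + 1) = c t;
  curve_derivable : forall t, derivable c t 1;
  curve_C1 : continuous (derive1 c);
  curve_immersed : forall t, derive1 c t != 0;
  curve_transverse : forall s t, 0 <= s < 1 -> 0 <= t < 1 -> s != t ->
    c s = c t -> det2 (derive1 c s) (derive1 c t) != 0;
  curve_double : forall r s t, 0 <= r < 1 -> 0 <= s < 1 -> 0 <= t < 1 ->
    c r = c s -> c s = c t -> [\/ r = s, s = t | r = t];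
  classical_double : forall x, x \in X ->
    [/\ 0 <= x.1 < 1, 0 <= x.2 < 1, x.1 != x.2 & c x.1 = c x.2];
  classical_over_under : forall x, x \in X -> (x.2, x.1) \notin X
}.

Record diagram := Diagram {
  curve : R -> R * R;
  classical : {fset R * R};
  diagramP : is_diagram curve classical
}.

Implicit Types D E : diagram.

Definition velocity D t : R * R := derive1 (curve D) t.

(* D has a classical crossing at which the strand through s passes over the
   strand through t; s and t are arbitrary lifts to R *)
Definition over_at D s t : Prop := (frac s, frac t) \in classical D.

(** * Gauss diagrams *)

(* tail (over-crossing point), head (under-crossing point), sign (true is +1) *)
Definition chord : Type := (R * R * bool)%type.
Definition tail (c : chord) : R := c.1.1.
Definition head (c : chord) : R := c.1.2.
Definition csign (c : chord) : bool := c.2.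

(* The crossing is positive when the over strand is rotated counterclockwise
   (by less than a half turn) onto the under strand. *)
Definition gauss_chord D (x : R * R) : chord :=
  (x.1, x.2, 0 < det2 (velocity D x.1) (velocity D x.2)).

Definition gauss D : {fset chord} := [fset gauss_chord D x | x in classical D]%fset.

(* open arc of the circle from a to b, counterclockwise; a, b, t in [0,1[ *)
Definition open_arc a b t : bool :=
  if a < b then a < t < b else (a < t) || (t < b).

(* When the chord c points upwards, the counterclockwise arc from its tail to
   its head is the right-hand side of the circle. *)
Definition on_right (c : chord) t : bool := open_arc (tail c) (head c) t.
Definition on_left (c : chord) t : bool := open_arc (head c) (tail c) t.

Definition chords_meet (c d : chord) : bool :=
  (on_right c (head d) && on_left c (tail d))
  || (on_left c (head d) && on_right c (tail d)).

Definition r_count (G : {fset chord}) (c : chord) (e : bool) : nat :=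
  #|` [fset d in G | [&& csign d == e, chords_meet c d & on_right c (head d)]]%fset|.
Definition l_count (G : {fset chord}) (c : chord) (e : bool) : nat :=
  #|` [fset d in G | [&& csign d == e, chords_meet c d & on_left c (head d)]]%fset|.

Definition chord_index (G : {fset chord}) (c : chord) : int :=
  (r_count G c true)%:Z - (r_count G c false)%:Z
  + (l_count G c false)%:Z - (l_count G c true)%:Z.

(* total Gaussian parity: 0 is even, 1 is odd *)
Definition gauss_parity (G : {fset chord}) (c : chord) : nat :=
  if chord_index G c == 0 then 0%N else 1%N.

(** * Manturov projection *)

Definition even_crossings D : {fset R * R} :=
  [fset x in classical D | gauss_parity (gauss D) (gauss_chord D x) == 0%N]%fset.

Lemma even_crossings_diagram D : is_diagram (curve D) (even_crossings D).
Proof.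
have sub x : x \in even_crossings D -> x \in classical D.
  by rewrite !inE => /andP[].
case: (diagramP D) => H1 H2 H3 H4 H5 H6 H7 H8.
split=> // [x /sub /H7 //|x /sub /H8].
by apply: contraNN => /sub.
Qed.

Definition manturov D : diagram := Diagram (even_crossings_diagram D).

Lemma manturov_stabilizes D :
  exists n, iter n.+1 manturov D = iter n manturov D.
Proof.
suff: forall m D, (#|` classical D| <= m)%N ->
    exists n, iter n.+1 manturov D = iter n manturov D.
  by move=> /(_ _ D (leqnn _)).
elim=> [|m IHm] {}D leDm.
all: have sub : (even_crossings D `<=` classical D)%fset
  by apply/fsubsetP => x; rewrite !inE => /andP[].
all: have [eqX|neqX] := eqVneq (even_crossings D) (classical D).
1,3: exists 0%N; rewrite /= /manturov; move: (even_crossings_diagram D);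
  rewrite eqX; case: D {leDm sub eqX} => c X P /= P';
  by congr Diagram; apply: Prop_irrelevance.
all: have ltX : (#|` even_crossings D| < #|` classical D|)%N
  by apply: fproper_ltn_card; rewrite fproperEneq neqX.
  by move: (leq_trans ltX leDm).
have [|n eqn] := IHm (manturov D); first by rewrite -ltnS (leq_trans ltX).
by exists n.+1; rewrite [LHS]iterSr [RHS]iterSr.
Qed.

(* The value does not depend on the choice of n. *)
Definition stable_manturov D : diagram :=
  iter (projT1 (cid (manturov_stabilizes D))) manturov D.

(** * Maps of the plane carrying one diagram to another *)

(* orientation-preserving C^1 automorphisms of R/Z, lifted to R *)
Definition circle_diffeo (sigma : R -> R) : Prop :=
  [/\ forall t, sigma (t + 1) = sigma t + 1,
      forall t, derivable sigma t 1,
      continuous (derive1 sigma)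
    & forall t, 0 < derive1 sigma t].

Definition carries (phi : R * R -> R * R) D E : Prop :=
  exists sigma : R -> R,
    [/\ circle_diffeo sigma,
        forall t, phi (curve D t) = curve E (sigma t)
      & forall s t, over_at D s t <-> over_at E (sigma s) (sigma t)].

Definition rotation (theta : R) p : R * R :=
  (cos theta * p.1 - sin theta * p.2, sin theta * p.1 + cos theta * p.2).

(* The rotation maps the oriented curve onto itself, inducing a diffeomorphism of
   the parameter circle (necessarily orientation-preserving, since its fixed
   points would lie over the origin). *)
Definition q_periodic (q : nat) D : Prop :=
  (forall t, curve D t != 0) /\ carries (rotation (2 * pi / q%:R)) D D.

(* orientation-preserving C^1 diffeomorphisms of the plane; the inverse is C^1
   because the Jacobian does not vanish *)
Definition plane_diffeo (phi : R * R -> R * R) : Prop :=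
  [/\ bijective phi,
      forall p, differentiable phi p,
      forall v, continuous (fun p => 'd phi p v)
    & forall p, 0 < det2 ('d phi p (1, 0)) ('d phi p (0, 1))].

Definition ambient_isotopy (H : R -> R * R -> R * R) : Prop :=
  [/\ forall p, H 0 p = p,
      forall t, 0 <= t <= 1 -> plane_diffeo (H t)
    & {within [set x : R * (R * R) | 0 <= x.1 <= 1],
        continuous (fun x => H x.1 x.2)}].

Definition planar_isotopy D E : Prop :=
  exists2 H, ambient_isotopy H & carries (H 1) D E.

(** * Moves *)

(* t lies on the closed arc [a,b] of R/Z *)
Definition in_arc a b t : Prop := exists m : int, a <= t + m%:~R <= b.

(* E is obtained from D by replacing the arc [a,b] of the curve, all classical
   crossings not involving this arc being kept *)
Definition reroute a b D E : Prop :=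
  [/\ a < b < a + 1,
      forall t, ~ in_arc a b t -> curve E t = curve D t
    & forall s t, ~ in_arc a b s -> ~ in_arc a b t ->
        (over_at E s t <-> over_at D s t)].

Definition all_virtual a b D : Prop :=
  forall s t, over_at D s t -> ~ in_arc a b s /\ ~ in_arc a b t.

Definition detour D E : Prop :=
  exists a b, [/\ reroute a b D E, all_virtual a b D & all_virtual a b E].

(* The classical moves take place in the square [-1,1] x [-1,1], the unit ball
   of the sup norm of R * R; any other disk is brought there by a planar
   isotopy.  The diagram meets the square in k arcs [a i, b i]. *)
Definition in_window (k : nat) (a b : 'I_k -> R) D : Prop :=
  [/\ forall i, a i < b i < a i + 1,
      forall i j t, i != j -> in_arc (a i) (b i) t -> ~ in_arc (a j) (b j) t,
      forall i t, a i < t < b i -> `|curve D t| < 1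
    & forall t, (forall i, ~ in_arc (a i) (b i) t) -> 1 < `|curve D t|].

(* The arc [a,b] is a graph y = f(x) over -1 <= x <= 1, with |f| < 1, traversed
   from left to right or from right to left. *)
Definition graph_strand a b D : Prop :=
  [/\ (forall t, a <= t <= b -> 0 < (velocity D t).1)
        \/ (forall t, a <= t <= b -> (velocity D t).1 < 0),
      `|(curve D a).1| = 1,
      `|(curve D b).1| = 1
    & forall t, a <= t <= b -> `|(curve D t).2| < 1].

Definition reidemeister1 D E : Prop :=
  exists a b : 'I_1 -> R,
    let a0 := a ord0 in let b0 := b ord0 in
    [/\ in_window a b D, in_window a b E, reroute a0 b0 D E,
        forall s t, a0 <= s <= b0 -> a0 <= t <= b0 ->
          curve D s = curve D t -> s = t
      & exists s0 t0,
        [/\ a0 < s0 /\ s0 < t0 < b0,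
            forall s t, a0 <= s -> s < t -> t <= b0 ->
              (curve E s = curve E t <-> s = s0 /\ t = t0)
          & over_at E s0 t0 \/ over_at E t0 s0]].

(* The two strands are disjoint in D; in E the rerouted strand 0 crosses
   strand 1 exactly twice, over it both times or under it both times. *)
Definition reidemeister2 D E : Prop :=
  exists a b : 'I_2 -> R,
    let i0 : 'I_2 := ord0 in let i1 : 'I_2 := ord_max in
    [/\ in_window a b D /\ in_window a b E,
        forall i, graph_strand (a i) (b i) D /\ graph_strand (a i) (b i) E,
        reroute (a i0) (b i0) D E,
        forall s t, a i0 <= s <= b i0 -> a i1 <= t <= b i1 ->
          curve D s <> curve D t
      & exists s1 s2 t1 t2,
        [/\ s1 != s2,
            [/\ a i0 < s1 < b i0, a i0 < s2 < b i0,
                a i1 < t1 < b i1 & a i1 < t2 < b i1],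
            forall s t, a i0 <= s <= b i0 -> a i1 <= t <= b i1 ->
              (curve E s = curve E t <->
                 (s = s1 /\ t = t1) \/ (s = s2 /\ t = t2))
          & (over_at E s1 t1 /\ over_at E s2 t2)
              \/ (over_at E t1 s1 /\ over_at E t2 s2)]].

(* Any two of the three strands cross exactly once, classically, strand j being
   above strand k for j < k; x j k is the parameter on strand j of its crossing
   with strand k. *)
Definition triangle (a b : 'I_3 -> R) (x : 'I_3 -> 'I_3 -> R) D : Prop :=
  [/\ in_window a b D,
      forall j, graph_strand (a j) (b j) D,
      forall j k, j != k -> a j < x j k < b j,
      forall j k s t, j != k -> a j <= s <= b j -> a k <= t <= b k ->
        (curve D s = curve D t <-> s = x j k /\ t = x k j)
    & forall j k : 'I_3, (j < k)%N -> over_at D (x j k) (x k j)].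

(* Strand i is pushed across the crossing of the two other strands, which do
   not move; on each strand the order of the two crossings gets reversed. *)
Definition slide (a b : 'I_3 -> R) (i : 'I_3) D E : Prop :=
  exists x y : 'I_3 -> 'I_3 -> R,
    [/\ triangle a b x D, triangle a b y E, reroute (a i) (b i) D E
      & forall j k l, uniq [:: j; k; l] -> (x j k < x j l <-> y j l < y j k)].

(* The outcome of a third move is, up to planar isotopy, the same whichever of
   the three strands (top, middle or bottom) is pushed across the crossing of
   the other two; all three descriptions are recorded. *)
Definition reidemeister3 D E : Prop :=
  exists a b : 'I_3 -> R,
    forall i, exists2 D', slide a b i D D' & planar_isotopy D' E.

Inductive same_virtual_knot : diagram -> diagram -> Prop :=
| SvkIsotopy D E : planar_isotopy D E -> same_virtual_knot D E
| SvkR1 D E : reidemeister1 D E -> same_virtual_knot D E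
| SvkR2 D E : reidemeister2 D E -> same_virtual_knot D E
| SvkR3 D E : reidemeister3 D E -> same_virtual_knot D E
| SvkDetour D E : detour D E -> same_virtual_knot D E
| SvkRefl D : same_virtual_knot D D
| SvkSym D E : same_virtual_knot D E -> same_virtual_knot E D
| SvkTrans D E F : same_virtual_knot D E -> same_virtual_knot E F ->
    same_virtual_knot D F.

(** * Alexander numberings *)

Definition crossing_point D t : Prop :=
  exists s, over_at D s t \/ over_at D t s.

Definition value_before (L : R -> int) t (l : int) : Prop :=
  \forall s \near t^'-, L s = l.
Definition value_after (L : R -> int) t (l : int) : Prop :=
  \forall s \near t^'+, L s = l.

(* L is a function on the short arcs, viewed as a locally constant function of
   the parameter; its values at the crossing points themselves are irrelevant.
   Draw a classical crossing with both strands oriented downwards.  Its strands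
   s, t satisfy 0 < det2 (velocity s) (velocity t) exactly when t runs from
   upper left to lower right and s from upper right to lower left, so that the
   left-hand arcs are the incoming part of t and the outgoing part of s. *)
Definition alexander_numbering D (L : R -> int) : Prop :=
  [/\ forall t, L (t + 1) = L t,
      forall s t, s <= t ->
        (forall r, s <= r <= t -> ~ crossing_point D r) -> L s = L t
    & forall s t, over_at D s t \/ over_at D t s ->
        0 < det2 (velocity D s) (velocity D t) ->
        exists l : int,
          (value_before L t l /\ value_after L s l) /\
          (value_after L t (l + 1) /\ value_before L s (l + 1))].

Definition almost_classical D : Prop := exists L, alexander_numbering D L.

Definition represents_almost_classical_knot D : Prop :=
  exists2 A, almost_classical A & same_virtual_knot D A.

End Diagrams.

Arguments diagram R : clear implicits.

(* Main.v *)
(** Let L be the integer function on the line that jumps by +e when the curve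
    passes under, and by -e when it passes over, a classical crossing of sign e.
    It is periodic, and a crossing with over-parameter s and under-parameter t
    has index L t - L s - e (right-continuous values).  Hence L is an Alexander
    numbering exactly when all indices vanish, and any Alexander numbering differs
    from L by a constant.

    The projection is functorial: it turns equivalent diagrams into equivalent
    ones.  Isotopies and detours carry L to L.  A kink has index 0; the two
    crossings of a second move have equal indices, and if these are nonzero the
    move becomes a detour.  In a third move the index of each crossing is
    preserved and, for the strands 0, 1, 2 from top to bottom,
    I(02) = I(01) + I(12); so if some crossing is odd then two are, they share a
    strand, and pushing that strand becomes a detour.  Consequently, if K is
    equivalent to an almost classical A, then P^n K is equivalent to P^n A = A,
    hence to K. *)
Require Import Defs.
From HB Require Import structures.
From mathcomp Require Import all_boot all_order all_algebra finmap.
From mathcomp Require Import all_classical all_reals all_analysis.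
From mathcomp Require Import zify ring lra.
Set Implicit Arguments.
Unset Strict Implicit.
Unset Printing Implicit Defensive.
Import Order.TTheory GRing.Theory Num.Theory.
Import numFieldNormedType.Exports Defs.
Local Open Scope classical_set_scope.
Local Open Scope ring_scope.

(** * Lifts of points of the circle *)

Section Lifts.
Context {R : realType}.
Implicit Types (a b p s t u : R) (m : int).

(** The index of a crossing depends on the whole diagram, so a local move might change it anywhere.
    Splitting [rise] into the crossings inside and outside the window of the move leaves finitely
    many integers: floors of differences of parameters, which are constant between two distinct
    strands and record an order on a single one. What remains is to relate the signs of the
    crossings inside the window, and these are geometric data, orientations of pairs of velocities.
    The relations are obtained by viewing the strands as graphs over [[-1, 1]]: the difference of
    two heights has simple roots at the crossings and keeps its sign between them, so its value at
    one well-chosen abscissa links two signs. Periodicity is handled together with isotopy, since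
    both rest on a map of the plane that preserves orientation. In a third move, the parities
    dictate which strand has to be pushed; this is where the availability of all three slides from
    the same diagram is used. *)

Lemma floorBz p m : Num.floor (p - m%:~R) = Num.floor p - m.
Proof. by rewrite -mulrNz floorDrz ?intr_int // intrKfloor. Qed.

Lemma floorDz p m : Num.floor (p + m%:~R) = Num.floor p + m.
Proof. by rewrite floorDrz ?intr_int // intrKfloor. Qed.

Lemma floor_unique p m : m%:~R <= p -> p < m%:~R + 1 -> Num.floor p = m.
Proof. by move=> h1 h2; apply: floor_def; rewrite h1 intrD. Qed.

Lemma frac_itv t : 0 <= frac t < 1.
Proof.
have /andP[h1 h2] := floor_itv t; rewrite intrD in h2.
by rewrite /frac subr_ge0 h1 ltrBlDl.
Qed.

Lemma frac_id t : 0 <= t < 1 -> frac t = t.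
Proof.
by case/andP=> h1 h2; rewrite /frac (@floor_unique t 0) ?subr0 ?add0r.
Qed.

Lemma fracDz t m : frac (t + m%:~R) = frac t.
Proof. by rewrite /frac floorDz intrD; ring. Qed.

Lemma fracK t : t = frac t + (Num.floor t)%:~R.
Proof. by rewrite subrK. Qed.

Lemma frac_eqP s t : frac s = frac t <-> exists m, t = s + m%:~R.
Proof.
split=> [e|[m ->]]; last by rewrite fracDz.
exists (Num.floor t - Num.floor s); rewrite intrB {1}(fracK t) -e /frac; ring.
Qed.

(* for s <= t, the number of lifts of p in ]s, t] *)
Definition cnt p s t : int := Num.floor (t - p) - Num.floor (s - p).

Lemma cntDz p m s t : cnt (p + m%:~R) s t = cnt p s t.
Proof. by rewrite /cnt !opprD !addrA !floorBz; ring. Qed.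

Lemma cnt_frac p s t : cnt (frac p) s t = cnt p s t.
Proof. by rewrite [in RHS](fracK p) cntDz. Qed.

Lemma cnt_trans p s t u : cnt p s u = cnt p s t + cnt p t u.
Proof. by rewrite /cnt; ring. Qed.

(** As [p] moves along the arc, [Num.floor (t - p)] changes only when [p] crosses a lift of [t], and
    the arc contains none. *)
Lemma floor_arc a b p q t : a <= p <= b -> a <= q <= b -> ~ in_arc a b t ->
  Num.floor (t - p) = Num.floor (t - q).
Proof.
move=> hp hq ht; apply/eqP; rewrite eq_le.
have key u v : a <= u <= b -> a <= v <= b ->
    Num.floor (t - u) <= Num.floor (t - v).
  move=> hu hv; rewrite leNgt; apply/negP => h; apply: ht.
  (* This shift gives the first lift of [t] at or after [u]; by [h] it comes before [v]. *)
  exists (- Num.floor (t - u)).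
  move: h (floor_le (t - u)); rewrite floor_lt_int mulrNz.
  by move: hu hv; move: (_%:~R) => z; lra.
by rewrite !key.
Qed.

Lemma floor_arc_r a b p q t : a <= p <= b -> a <= q <= b -> ~ in_arc a b t ->
  Num.floor (p - t) = Num.floor (q - t).
Proof.
move=> hp hq ht; apply/eqP; rewrite eq_le.
have key u v : a <= u <= b -> a <= v <= b ->
    Num.floor (u - t) <= Num.floor (v - t).
  move=> hu hv; rewrite leNgt; apply/negP => h; apply: ht.
  exists (Num.floor (u - t)).
  move: h (floor_le (u - t)); rewrite floor_lt_int.
  by move: hu hv; move: (_%:~R) => z; lra.
by rewrite !key.
Qed.

Lemma cnt_in_arc a b p s t : a <= s <= b -> a <= t <= b -> ~ in_arc a b p ->
  cnt p s t = 0.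
Proof.
by move=> hs ht hp; rewrite /cnt (floor_arc_r hs ht hp) subrr.
Qed.

Lemma in_arc_self a b t : a <= t <= b -> in_arc a b t.
Proof. by move=> h; exists 0; rewrite addr0. Qed.

Lemma in_arcDz a b t m : in_arc a b (t + m%:~R) <-> in_arc a b t.
Proof.
split=> -[k hk]; first by exists (m + k); rewrite intrD addrA.
by exists (k - m); move: hk; rewrite intrB; lra.
Qed.

Lemma in_arc_frac a b t : in_arc a b (frac t) <-> in_arc a b t.
Proof. by rewrite [in X in _ <-> X](fracK t) in_arcDz. Qed.

End Lifts.
(** * The index of a crossing *)

(* locked because unifying two velocities is costly *)
HB.lock Definition sgn (R : realType) (D : diagram R) (s t : R) : int :=
  if 0 < det2 (velocity D s) (velocity D t) then 1 else -1.

Section Crossings.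
Context {R : realType}.
Implicit Types (D E : diagram R) (s t u : R) (m : int) (x y : R * R).

Lemma sgnE D s t :
  sgn D s t = if 0 < det2 (velocity D s) (velocity D t) then 1 else -1.
Proof. by rewrite sgn.unlock. Qed.

(* The increase, from s to t, of a right-continuous function that jumps by the
   sign of the crossing at each head and by minus this sign at each tail. *)
Definition rise D s t : int :=
  \sum_(y <- classical D) sgn D y.1 y.2 * (cnt y.2 s t - cnt y.1 s t).

Lemma periodic_intr (T : Type) (f : R -> T) :
  (forall t, f (t + 1) = f t) -> forall t m, f (t + m%:~R) = f t.
Proof.
move=> fP.
have fn n t : f (t + n%:R) = f t.
  by elim: n => [|n <-]; rewrite ?addr0 // -natr1 addrA fP.
move=> t [n|n]; first exact: fn.
by rewrite -[in RHS](subrK n.+1%:R t) fn NegzE mulrNz.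
Qed.

Lemma curveDz D t m : curve D (t + m%:~R) = curve D t.
Proof. by apply: periodic_intr => {}t; case: (diagramP D). Qed.

Lemma curve_frac D t : curve D (frac t) = curve D t.
Proof. by rewrite [in RHS](fracK t) curveDz. Qed.

Lemma velocityDz D t m : velocity D (t + m%:~R) = velocity D t.
Proof.
apply: periodic_intr => {}t; rewrite /velocity /derive1.
suff -> : (fun h => h^-1 *: (curve D (h + (t + 1)) - curve D (t + 1))) =
    (fun h => h^-1 *: (curve D (h + t) - curve D t)) by [].
by apply/funext => h; rewrite addrA; case: (diagramP D) => cP *; rewrite !cP.
Qed.

Lemma velocity_frac D t : velocity D (frac t) = velocity D t.
Proof. by rewrite [in RHS](fracK t) velocityDz. Qed.

Lemma sgn_frac D s t : sgn D (frac s) (frac t) = sgn D s t.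
Proof. by rewrite !sgnE !velocity_frac. Qed.

Lemma over_at_frac D s t : over_at D (frac s) (frac t) <-> over_at D s t.
Proof. by rewrite /over_at !(frac_id (frac_itv _)). Qed.

Lemma over_at_classical D x : x \in classical D -> over_at D x.1 x.2.
Proof.
move=> xD; have [h1 h2 _ _] := classical_double (diagramP D) xD.
by rewrite /over_at !frac_id // -surjective_pairing.
Qed.

Lemma over_atP D s t :
  over_at D s t -> frac s != frac t /\ curve D s = curve D t.
Proof.
by move=> /(classical_double (diagramP D)) /= [_ _ h]; rewrite !curve_frac.
Qed.

Lemma over_at_asym D s t : over_at D s t -> ~ over_at D t s.
Proof. by move=> /(classical_over_under (diagramP D)) /negP. Qed.

Lemma double_frac D r s t : curve D r = curve D s -> curve D s = curve D t ->
  [\/ frac r = frac s, frac s = frac t | frac r = frac t].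
Proof.
move=> h1 h2; apply: (curve_double (diagramP D)); rewrite ?frac_itv //.
all: by rewrite !curve_frac.
Qed.

(** There are no triple points, so a parameter on a double point determines the other one modulo 1,
    whichever strand is on top. *)
Lemma over_at_partner D s t s' t' :
  over_at D s t \/ over_at D t s -> over_at D s' t' \/ over_at D t' s' ->
  frac s = frac s' -> frac t = frac t'.
Proof.
move=> h h' e.
have [n1 c1] : frac s != frac t /\ curve D s = curve D t.
  by case: h => /over_atP[]; rewrite // eq_sym.
have [n2 c2] : frac s' != frac t' /\ curve D s' = curve D t'.
  by case: h' => /over_atP[]; rewrite // eq_sym.
have c3 : curve D t = curve D t' by rewrite -c1 -c2 -curve_frac e curve_frac.
have [k|//|k] := double_frac c1 c3; first by rewrite k eqxx in n1.
by rewrite -k e eqxx in n2.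
Qed.

Lemma over_at_over D s t t' :
  over_at D s t -> over_at D s t' -> frac t = frac t'.
Proof. by move=> h h'; apply: over_at_partner; [left; exact: h|left; exact: h'|]. Qed.

Lemma over_at_under D s s' t :
  over_at D s t -> over_at D s' t -> frac s = frac s'.
Proof. by move=> h h'; apply: over_at_partner; [right; exact: h|right; exact: h'|]. Qed.

Lemma over_at_mixed D s t u : over_at D s t -> ~ over_at D t u.
Proof.
move=> h h'; have e : frac s = frac u.
  by apply: over_at_partner; [right; exact: h|left; exact: h'|].
by apply: (over_at_asym h); rewrite /over_at e.
Qed.

Lemma rise_trans D s t u : rise D s u = rise D s t + rise D t u.
Proof.
rewrite /rise -big_split /=; apply: eq_bigr => y _.
by rewrite (cnt_trans _ s t u) (cnt_trans y.1 s t u); ring.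
Qed.

(** A full turn meets each crossing once over and once under, and the two jumps cancel. *)
Lemma risetDz D s t m : rise D s (t + m%:~R) = rise D s t.
Proof.
rewrite /rise; apply: eq_bigr => y _; rewrite /cnt.
by rewrite ![t + _ - _]addrAC !floorDz; ring.
Qed.

Lemma risesDz D s t m : rise D (s + m%:~R) t = rise D s t.
Proof.
rewrite /rise; apply: eq_bigr => y _; rewrite /cnt.
by rewrite ![s + _ - _]addrAC !floorDz; ring.
Qed.

Lemma rise_frac D s t : rise D (frac s) (frac t) = rise D s t.
Proof. by rewrite [in RHS](fracK s) [in RHS](fracK t) risesDz risetDz. Qed.

End Crossings.

(** * The index read from the Gauss diagram as a rise *)

Section Index.
Context {R : realType}.
Implicit Types (D E : diagram R) (s t u : R) (m : int) (x y : R * R).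

Lemma card_fset_sep (K : choiceType) (G : {fset K}) (P : pred K) :
  (#|` [fset d in G | P d]%fset|)%:Z = \sum_(d <- G) (P d)%:Z.
Proof.
have -> : (#|` [fset d in G | P d]%fset| = \sum_(d <- G) P d)%N.
  have -> : (\sum_(d <- G) P d = \sum_(d <- G | P d) 1)%N.
    by rewrite [RHS]big_mkcond; apply: eq_bigr => d _; case: (P d).
  rewrite sum1_count -size_filter; apply: perm_size.
  apply: uniq_perm; rewrite ?fset_uniq ?filter_uniq ?fset_uniq // => d.
  by rewrite mem_filter !inE andbC.
by elim/big_rec2: _ => // d m n _ <-; rewrite PoszD.
Qed.

Lemma sum_pick (K : eqType) (r : seq K) (F : K -> int) (x : K) : uniq r -> x \in r ->
  \sum_(y <- r) F y * (y == x)%:Z = F x.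
Proof.
move=> ur xr; rewrite (big_rem x) //= eqxx mulr1 big1_seq ?addr0 // => y /andP[_].
by rewrite mem_rem_uniq // inE => /andP[/negbTE-> _]; rewrite mulr0.
Qed.

(** [cnt] counts on []a, b]], closed at [b], hence the correction for [p = b]. When [b < a] the arc
    wraps around 0 and [cnt] is minus the count on []b, a]], outside the arc, hence the added 1. *)
Lemma on_right_cnt (a b p : R) :
  0 <= a < 1 -> 0 <= b < 1 -> 0 <= p < 1 -> a != b ->
  (open_arc a b p)%:Z = cnt p a b - (p == b)%:Z + (b < a)%R%:Z.
Proof.
move=> ha hb hp ab.
have key (v : R) : 0 <= v < 1 -> Num.floor (v - p) = - (v < p)%R%:Z.
  move=> /andP[hv1 hv2]; have /andP[hp1 hp2] := hp; have [h|h] := ltP v p.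
    by apply: floor_unique; rewrite mulrN1z; lra.
  by apply: floor_unique; rewrite oppr0 mulr0z; lra.
rewrite /cnt !key // /open_arc.
have [->|pb] := eqVneq p b.
  by rewrite ltxx; case: ltgtP ab.
case: (ltgtP a b) ab => // h _; case: (ltgtP a p) => h1; case: (ltgtP p b) pb => h2 //= _; exfalso; lra.
Qed.

Definition chord_term (c d : @chord R) : int :=
  let cond b r := [&& csign d == b, chords_meet c d & r c (head d)]%:Z in
  cond true on_right - cond false on_right + cond false on_left - cond true on_left.

Lemma chord_index_sum (G : {fset @chord R}) (c : @chord R) :
  chord_index G c = \sum_(d <- G) chord_term c d.
Proof.
by rewrite /chord_term sumrB big_split sumrB /chord_index /r_count /l_count !card_fset_sep.
Qed.

(** A chord that does not meet [(a, b)] has both ends on one side and the difference vanishes;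
    otherwise the difference is 1 or -1 according to the side of the head, which matches the four
    signs in the index. *)
Lemma chord_termE (a b u v : R) (e e' : bool) :
  a != b -> u != a -> u != b -> v != a -> v != b ->
  chord_term (a, b, e) (u, v, e') =
  (if e' then 1 else -1) * ((open_arc a b v)%:Z - (open_arc a b u)%:Z).
Proof.
move=> ab ua ub va vb; rewrite /chord_term /chords_meet /on_right /on_left /head /tail /csign.
have arcC p : p != a -> p != b -> open_arc b a p = ~~ open_arc a b p.
  rewrite /open_arc; move: ab.
  case: (ltgtP a b) => // h _; case: (ltgtP p a) => // h1 _; case: (ltgtP p b) => // h2 _; exfalso; lra.
rewrite !(arcC u) // !(arcC v) //; clear.
by case: e' (open_arc a b u) (open_arc a b v) => [] [] [].
Qed.

Lemma chord_term_id (a b : R) e : a != b ->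
  chord_term (a, b, e) (a, b, e) = 0.
Proof.
rewrite /chord_term /chords_meet /on_right /on_left /head /tail /csign /open_arc => ab.
by rewrite !ltxx !andbF /=; case: (ltgtP a b) ab => //; rewrite !andbF.
Qed.

Lemma gauss_chord1 D x : (gauss_chord D x).1 = x.
Proof. by case: x. Qed.

Lemma gauss_chord_inj D : injective (gauss_chord D).
Proof.
move=> y z h.
have h1 := gauss_chord1 D y; have h2 := gauss_chord1 D z.
have h3 := etrans (esym h1) (congr1 (@fst _ _) h).
exact: (etrans h3 h2).
Qed.

(** The two sums agree term by term except at [x] itself. A chord does not meet itself, but [rise]
    counts its head and not its tail, intervals being open on the left and closed on the right; this
    surplus is the sign of [x]. *)
Lemma chord_index_rise D x : x \in classical D ->
  chord_index (gauss D) (gauss_chord D x) = rise D x.1 x.2 - sgn D x.1 x.2.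
Proof.
move=> xD; have [hx1 hx2 hx12 _] := classical_double (diagramP D) xD.
rewrite chord_index_sum /gauss big_imfset; last exact: (in2W (@gauss_chord_inj D)).
(* The subtracted sign is written as a sum supported at [x], so that the summands can be compared
   one by one. *)
rewrite -[X in _ - X](sum_pick (fun y => sgn D y.1 y.2) (fset_uniq _) xD).
rewrite /rise -sumrB !big_seq; apply: eq_bigr => y yD.
have [hy1 hy2 hy12 _] := classical_double (diagramP D) yD.
rewrite /gauss_chord -mulrBr.
have ox := over_at_classical xD; have oy := over_at_classical yD.
have [yx|yx] := eqVneq y x.
  rewrite yx chord_term_id //.
  have := @on_right_cnt x.1 x.2 x.2 hx1 hx2 hx2 hx12.
  have := @on_right_cnt x.1 x.2 x.1 hx1 hx2 hx1 hx12.
  rewrite /open_arc !ltxx !andbF (negbTE hx12) eqxx; case: ltgtP hx12 => //= _ _ h1 h2.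
    rewrite (_ : cnt x.2 _ _ - _ - _ = 0) ?mulr0 //.
    by move: (cnt x.2 _ _) (cnt x.1 _ _) h1 h2; clear; lia.
  rewrite (_ : cnt x.2 _ _ - _ - _ = 0) ?mulr0 //.
  by move: (cnt x.2 _ _) (cnt x.1 _ _) h1 h2; clear; lia.
have n1 : y.1 != x.1.
  apply: contra_neq yx => e; apply/eqP; rewrite -pair_eqE /= e eqxx /=.
  rewrite -(frac_id hy2) -(frac_id hx2); apply/eqP/(over_at_over oy); by rewrite e.
have n2 : y.2 != x.2.
  apply: contra_neq yx => e; apply/eqP; rewrite -pair_eqE /= e eqxx andbT.
  rewrite -(frac_id hy1) -(frac_id hx1); apply/eqP/(over_at_under oy); by rewrite e.
have n3 : y.2 != x.1 by apply/eqP => e; apply: (@over_at_mixed _ D y.1 y.2 x.2) => //; rewrite e.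
have n4 : y.1 != x.2 by apply/eqP => e; apply: (@over_at_mixed _ D x.1 x.2 y.2) => //; rewrite -e.
rewrite chord_termE // !on_right_cnt // sgnE (negbTE n2) (negbTE n4).
by congr (_ * _); rewrite !subr0; ring.
Qed.
Lemma over_at_manturov D s t :
  over_at (manturov D) s t <-> over_at D s t /\ rise D s t = sgn D s t.
Proof.
have key : over_at D s t -> (gauss_parity (gauss D) (gauss_chord D (frac s, frac t)) == 0%N)
    = (rise D s t == sgn D s t).
  move=> h; rewrite /gauss_parity chord_index_rise // rise_frac sgn_frac subr_eq0.
  by case: ifP.
rewrite {1}/over_at; split=> [|[h /eqP e]].
  by rewrite !inE => /andP[h]; rewrite key // => /eqP.
by rewrite !inE -/(over_at D s t) h /= key.
Qed.

Lemma manturov_id D :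
  (forall s t, over_at D s t -> rise D s t = sgn D s t) -> manturov D = D.
Proof.
move=> h; have e : even_crossings D = classical D.
  apply/fsetP => x; have := @over_at_manturov D x.1 x.2.
  case: (boolP (x \in classical D)) => xD.
    have ox := over_at_classical xD => -[_ /(_ (conj ox (h _ _ ox)))].
    have [h1 h2 _ _] := classical_double (diagramP D) xD.
    by rewrite /over_at !frac_id // -surjective_pairing.
  by move=> _; rewrite !inE (negbTE xD).
rewrite /manturov; move: (even_crossings_diagram D); rewrite e.
by case: D {h e} => c X P /= P'; congr Diagram; apply: Prop_irrelevance.
Qed.

Lemma stable_manturov_fixed D :
  manturov (stable_manturov D) = stable_manturov D.
Proof. by rewrite /stable_manturov; case: cid. Qed.

Lemma stable_manturov_even D s t :
  over_at (stable_manturov D) s t ->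
  rise (stable_manturov D) s t = sgn (stable_manturov D) s t.
Proof. by rewrite -{1}stable_manturov_fixed => /over_at_manturov[]. Qed.

End Index.
(** * Alexander numberings *)

Lemma near_all_seq (T : Type) (F : set_system T) {FF : Filter F} (K : eqType)
    (r : seq K) (P : K -> T -> Prop) :
  (forall y : K, y \in r -> \forall s \near F, P y s) ->
  \forall s \near F, forall y : K, y \in r -> P y s.
Proof.
elim: r => [|z r IH] h; first by near=> s => y; rewrite in_nil.
have h1 := h z (mem_head z r).
have h2 := IH (fun y yr => h y (mem_behead (s := z :: r) yr)).
near=> s => y; rewrite in_cons => /orP[/eqP->|yr]; first by near: s.
have h3 : forall y, y \in r -> P y s by near: s; exact: h2.
exact: h3.
Unshelve. all: by end_near. Qed.

Section Alexander.
Context {R : realType}.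
Implicit Types (D E : diagram R) (s t u p : R) (m : int) (x y : R * R).

Lemma near_leftE (P : R -> Prop) t :
  (\forall s \near t^'-, P s) <-> exists2 e, e < t & forall s, e < s < t -> P s.
Proof.
split=> [|[e et h]]; last by near=> s; apply: h; apply/andP; split; near: s;
  [exact: nbhs_left_gt | exact: nbhs_left_lt].
rewrite near_withinE => -[e /= e0 h]; exists (t - e); first lra.
by move=> s hs; apply: h => /=; [rewrite ltr_distlC; lra | lra].
Unshelve. all: by end_near. Qed.

Lemma near_rightE (P : R -> Prop) t :
  (\forall s \near t^'+, P s) <-> exists2 e, t < e & forall s, t < s < e -> P s.
Proof.
split=> [|[e et h]]; last by near=> s; apply: h; apply/andP; split; near: s;
  [exact: nbhs_right_gt | exact: nbhs_right_lt].
rewrite near_withinE => -[e /= e0 h]; exists (t + e); first lra.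
by move=> s hs; apply: h => /=; [rewrite ltr_distlC; lra | lra].
Unshelve. all: by end_near. Qed.

Lemma floor_near_right p t :
  \forall s \near t^'+, Num.floor (s - p) = Num.floor (t - p) /\ frac p != frac s.
Proof.
have /andP[h1 h2] := floor_itv (t - p); rewrite intrD in h2.
apply/near_rightE; exists (p + (Num.floor (t - p))%:~R + 1); first lra.
move=> s hs; have e : Num.floor (s - p) = Num.floor (t - p) by apply: floor_unique; lra.
split=> //; apply/eqP => /frac_eqP[m sm].
have h : s - p = m%:~R by rewrite sm; ring.
by move: h e => -> ; rewrite intrKfloor => em; move: h1 hs; rewrite sm em; lra.
Qed.

Lemma floor_near_left p t :
  \forall s \near t^'-, Num.floor (s - p) = Num.floor (t - p) - (frac p == frac t)%:Z
    /\ frac p != frac s.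
Proof.
have /andP[h1 h2] := floor_itv (t - p); rewrite intrD in h2.
apply/near_leftE; have [/frac_eqP[m tm]|/eqP n] := eqVneq (frac p) (frac t).
  have h : t - p = m%:~R by rewrite tm; ring.
  rewrite h intrKfloor; exists (t - 1); first lra.
  move=> s hs; have e : Num.floor (s - p) = m - 1.
    by apply: floor_unique; rewrite intrB -h; lra.
  split=> //; apply/eqP => /frac_eqP[k sk].
  have h' : s - p = k%:~R by rewrite sk; ring.
  by move: h' e => -> ; rewrite intrKfloor => ek; move: h hs; rewrite sk ek intrB; lra.
rewrite subr0; exists (p + (Num.floor (t - p))%:~R).
  rewrite lt_neqAle; apply/andP; split; last lra.
  by apply/eqP => e; apply: n; apply/frac_eqP; exists (Num.floor (t - p)).
move=> s hs; have e : Num.floor (s - p) = Num.floor (t - p) by apply: floor_unique; lra.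
split=> //; apply/eqP => /frac_eqP[k sk].
have h' : s - p = k%:~R by rewrite sk; ring.
by move: h' e => -> ; rewrite intrKfloor => ek; move: hs; rewrite sk ek; lra.
Qed.

(** The value at [t] of the right-continuous function [rise D 0] minus its limit from the left, see
    [rise_near_left]. *)
Definition jump D t : int :=
  \sum_(y <- classical D) sgn D y.1 y.2 * ((frac y.2 == frac t)%:Z - (frac y.1 == frac t)%:Z).

Lemma not_crossing_point D t :
  (forall y, y \in classical D -> frac y.1 != frac t /\ frac y.2 != frac t) ->
  ~ crossing_point D t.
Proof.
by move=> h [s [] /h [] /=]; rewrite !(frac_id (frac_itv _)) eqxx.
Qed.

Lemma rise_near_right D t :
  \forall s \near t^'+, rise D 0 s = rise D 0 t /\ ~ crossing_point D s.
Proof.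
pose P y s := (Num.floor (s - y.1) = Num.floor (t - y.1) /\ frac y.1 != frac s) /\
  (Num.floor (s - y.2) = Num.floor (t - y.2) /\ frac y.2 != frac s).
have h : \forall s \near t^'+, forall y, y \in classical D -> P y s.
  apply: near_all_seq => y _; apply: filterI; exact: floor_near_right.
near=> s; have hs : forall y, y \in classical D -> P y s by near: s; exact: h.
split; last by apply: not_crossing_point => y /hs [[_ ?] [_ ?]].
rewrite /rise !big_seq; apply: eq_bigr => y /hs [[h1 _] [h2 _]].
by rewrite /cnt h1 h2.
Unshelve. all: by end_near. Qed.

Lemma rise_near_left D t :
  \forall s \near t^'-, rise D 0 s = rise D 0 t - jump D t /\ ~ crossing_point D s.
Proof.
pose Q p s := Num.floor (s - p) = Num.floor (t - p) - (frac p == frac t)%:Z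
    /\ frac p != frac s.
have h : \forall s \near t^'-, forall y, y \in classical D -> Q y.1 s /\ Q y.2 s.
  apply: near_all_seq => y _; apply: filterI; exact: floor_near_left.
near=> s; have hs : forall y, y \in classical D -> Q y.1 s /\ Q y.2 s by near: s; exact: h.
split; last by apply: not_crossing_point => y /hs [[_ ?] [_ ?]].
rewrite /rise /jump -sumrB !big_seq; apply: eq_bigr => y /hs [[h1 _] [h2 _]].
by rewrite /cnt h1 h2; ring.
Unshelve. all: by end_near. Qed.

Lemma jump_over D s t : over_at D s t -> jump D s = - sgn D s t.
Proof.
move=> o; pose x := (frac s, frac t); have xD : x \in classical D by [].
rewrite -(sgn_frac D s t) -(sum_pick (fun y => sgn D y.1 y.2) (fset_uniq _) xD).
rewrite /jump -sumrN !big_seq; apply: eq_bigr => y yD.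
have [h1 h2 _ _] := classical_double (diagramP D) yD.
have oy := over_at_classical yD; rewrite (frac_id h1) (frac_id h2) -[RHS]mulrN; congr (_ * _).
have -> : (y.2 == frac s) = false.
  apply/eqP => e; apply: (@over_at_mixed _ D y.1 s t) => //.
  by apply/over_at_frac; rewrite -e (frac_id h1).
have -> // : (y.1 == frac s) = (y == x); last by rewrite sub0r.
apply/eqP/eqP => [e|->//]; apply/eqP; rewrite -pair_eqE /= e eqxx /=.
rewrite -(frac_id h2); apply/eqP; apply: over_at_over (oy) _.
by apply/over_at_frac; rewrite (frac_id h1) e; exact/over_at_frac.
Qed.

Lemma jump_under D s t : over_at D s t -> jump D t = sgn D s t.
Proof.
move=> o; pose x := (frac s, frac t); have xD : x \in classical D by [].
rewrite -(sgn_frac D s t) -(sum_pick (fun y => sgn D y.1 y.2) (fset_uniq _) xD).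
rewrite /jump !big_seq; apply: eq_bigr => y yD.
have [h1 h2 _ _] := classical_double (diagramP D) yD.
have oy := over_at_classical yD; rewrite (frac_id h1) (frac_id h2); congr (_ * _).
have -> : (y.1 == frac t) = false.
  apply/eqP => e; apply: (@over_at_mixed _ D s t y.2) => //.
  by apply/over_at_frac; rewrite -e (frac_id h2).
have -> // : (y.2 == frac t) = (y == x); last by rewrite subr0.
apply/eqP/eqP => [e|->//]; apply/eqP; rewrite -pair_eqE /= e eqxx andbT.
rewrite -(frac_id h1); apply/eqP; apply: over_at_under (oy) _.
by apply/over_at_frac; rewrite (frac_id h2) e; exact/over_at_frac.
Qed.

Lemma jump_none D t : ~ crossing_point D t -> jump D t = 0.
Proof.
move=> n; rewrite /jump big1_seq // => y /andP[_ yD].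
have oy := over_at_classical yD.
case: eqP => [e|_]; first by case: n; exists y.1; left; rewrite /over_at -e.
case: eqP => [e|_]; first by case: n; exists y.2; right; rewrite /over_at -e.
by rewrite mulr0.
Qed.

Lemma det2C (u v : R * R) : det2 u v = - det2 v u.
Proof. by rewrite /det2; ring. Qed.

Lemma det2_over D s t : over_at D s t \/ over_at D t s ->
  det2 (velocity D s) (velocity D t) != 0.
Proof.
move=> o; have [n c] : frac s != frac t /\ curve D s = curve D t.
  by case: o => /over_atP[]; rewrite // eq_sym.
have := curve_transverse (diagramP D) (frac_itv s) (frac_itv t) n.
by rewrite !curve_frac => /(_ c); rewrite -!/(velocity D _) !velocity_frac.
Qed.

Lemma sgnC D s t : over_at D s t \/ over_at D t s -> sgn D t s = - sgn D s t.
Proof.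
move=> /det2_over; rewrite !sgnE; move: (velocity D s) (velocity D t) => u v d0.
by rewrite (det2C v u) oppr_gt0; case: ltgtP d0.
Qed.

Lemma sgnP D s t : over_at D s t \/ over_at D t s ->
  (0 < det2 (velocity D s) (velocity D t) /\ sgn D s t = 1) \/
  (0 < det2 (velocity D t) (velocity D s) /\ sgn D s t = -1).
Proof.
move=> /sgnC; rewrite !sgnE; move: (velocity D s) (velocity D t) => u v.
have [h1|h1] := ltP 0 (det2 u v); first by left.
by have [h2|h2] := ltP 0 (det2 v u); first by right.
Qed.

Lemma even_almost_classical D :
  (forall s t, over_at D s t -> rise D s t = sgn D s t) -> almost_classical D.
Proof.
move=> ev; exists (rise D 0); split.
- by move=> t; rewrite -(mulr1z 1) risetDz.
- move=> s t st h; apply/eqP; rewrite -subr_eq0 (rise_trans D 0 s t) opprD addNKr oppr_eq0.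
  apply/eqP; rewrite /rise big1_seq // => y /andP[_ yD].
  have oy := over_at_classical yD.
  have key p : (forall r, frac r = frac p -> crossing_point D r) -> cnt p s t = 0.
    move=> hp; apply/eqP; rewrite subr_eq0 eq_le andbC le_floor ?lerB //= leNgt.
    apply/negP; rewrite floor_lt_int => k; apply: (h (p + (Num.floor (t - p))%:~R)).
      by move: k (floor_le (t - p)); lra.
    by apply: hp; rewrite fracDz.
  rewrite !key ?mulr0 //.
    by move=> r e; exists y.2; right; rewrite /over_at e.
  by move=> r e; exists y.1; left; rewrite /over_at e.
- move=> s t o d.
  have st : sgn D s t = 1 by rewrite !sgnE d.
  have L u : value_before (rise D 0) u (rise D 0 u - jump D u).
    by apply: filterS (rise_near_left D u) => ? [].
  have Rr u : value_after (rise D 0) u (rise D 0 u).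
    by apply: filterS (rise_near_right D u) => ? [].
  (* By right continuity, the value at [s] is the number of the outgoing part of [s], which is a
     left-hand arc. *)
  exists (rise D 0 s); suff [e1 e2 e3] : [/\ rise D 0 t = rise D 0 s + 1,
      jump D t = 1 & jump D s = -1].
    have := L s; have := L t; have := Rr t.
    by rewrite e1 e2 e3 opprK addrK.
  case: o => o.
    by rewrite (rise_trans D 0 s t) (ev _ _ o) (jump_over o) (jump_under o) st.
  have ts : sgn D t s = -1 by rewrite sgnC; [rewrite st|right].
  rewrite [rise D 0 s](rise_trans D 0 t s) (ev _ _ o) (jump_over o) (jump_under o) ts.
  by rewrite subrK opprK.
Qed.

(** Such a function has zero derivative everywhere. *)
Lemma locally_constant (g : R -> R) :
  (forall t, \forall s \near t, g s = g t) -> forall s t, g s = g t.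
Proof.
move=> h s t; apply: is_derive_0_is_cst => {s t} x.
have e : \near x, cst (g x) x = g x by near=> s.
have e' : \forall s \near x, cst (g x) s = g s by apply: filterS (h x) => s ->.
apply: DeriveDef; first by apply: (near_eq_derivable e'); exact: derivable_cst.
by rewrite -(near_eq_derive _ e') derive_cst.
Unshelve. all: by end_near. Qed.

Lemma near_left_right (P : R -> Prop) t : P t ->
  (\forall s \near t^'-, P s) -> (\forall s \near t^'+, P s) -> \forall s \near t, P s.
Proof.
move=> h0; rewrite !near_withinE => h1 h2; near=> s.
have p1 : s < t -> P s by near: s; exact: h1.
have p2 : t < s -> P s by near: s; exact: h2.
by case: (ltgtP s t) => [/p1|/p2|->].
Unshelve. all: by end_near. Qed.

Lemma value_after_uniq (L : R -> int) t l l' :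
  value_after L t l -> value_after L t l' -> l = l'.
Proof.
move=> h h'; suff : \forall s \near t^'+, l = l' by move=> /filter_ex[].
by apply: filterS2 h h' => s -> .
Unshelve. all: by end_near. Qed.

Lemma value_after_near (L : R -> int) t l :
  value_after L t l -> \forall s \near t^'+, value_after L s l.
Proof.
move=> /near_rightE[e te h]; apply/near_rightE; exists e => // s /andP[h1 h2].
apply/near_rightE; exists e => // r /andP[h3 h4]; apply: h.
by rewrite h4 (lt_trans h1).
Qed.

Lemma value_before_near (L : R -> int) t l :
  value_before L t l -> \forall s \near t^'-, value_after L s l.
Proof.
move=> /near_leftE[e te h]; apply/near_leftE; exists e => // s /andP[h1 h2].
apply/near_rightE; exists t => // r /andP[h3 h4]; apply: h.
by rewrite h4 (lt_trans h1).
Qed.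

(** The values of [L] at the crossing points are arbitrary, so only its one-sided limits carry
    information. The crossing rule says that they differ by the sign of the crossing on the under
    strand and by its opposite on the over strand, which are the jumps of [rise D 0]. *)
Lemma alexander_values D L : alexander_numbering D L ->
  forall t, exists l, value_after L t l /\ value_before L t (l - jump D t).
Proof.
move=> [_ Lc Lx] t; have [|n] := pselect (crossing_point D t).
  move=> [s [] o].
    rewrite (jump_under o); have [[d ->]|[d ->]] := sgnP (or_introl o).
      by have [l [[? ?] [? ?]]] := Lx s t (or_introl o) d; exists (l + 1); rewrite addrK.
    by have [l [[? ?] [? ?]]] := Lx t s (or_intror o) d; exists l; rewrite opprK.
  rewrite (jump_over o); have [[d ->]|[d ->]] := sgnP (or_introl o); rewrite ?opprK.
    by have [l [[? ?] [? ?]]] := Lx t s (or_introl o) d; exists l; rewrite ?opprK.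
  by have [l [[? ?] [? ?]]] := Lx s t (or_intror o) d; exists (l + 1); rewrite addrK.
have [e te he] : exists2 e, t < e & forall s, t < s < e -> ~ crossing_point D s.
  by apply/near_rightE; apply: filterS (rise_near_right D t) => s [].
have [f tf hf] : exists2 f, f < t & forall s, f < s < t -> ~ crossing_point D s.
  by apply/near_leftE; apply: filterS (rise_near_left D t) => s [].
exists (L t); rewrite (jump_none n) subr0; split.
  apply/near_rightE; exists e => // s hs; apply/esym/Lc; first lra.
  move=> r hr; have [->//|rt] := eqVneq r t; apply: he.
  have tr : t < r by rewrite lt_neqAle eq_sym rt; case/andP: hr.
  by move: hr hs tr; lra.
apply/near_leftE; exists f => // s hs; apply/Lc; first lra.
move=> r hr; have [->//|rt] := eqVneq r t; apply: hf.
have tr : r < t by rewrite lt_neqAle rt; case/andP: hr.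
by move: hr hs tr; lra.
Qed.

(** Let [M] be the right-hand limits of [L]. Then [M] and [rise D 0] have the same jumps, so their
    difference is locally constant; it is cast to [R] to apply [locally_constant]. At a crossing,
    the rule for [L] then gives the rise from [s] to [t] as a difference of two outgoing numbers,
    which is the sign. *)
Lemma almost_classical_even D : almost_classical D ->
  forall s t, over_at D s t -> rise D s t = sgn D s t.
Proof.
move=> [L hL]; have [M hM] := choice (alexander_values hL).
have M1 t := (hM t).1; have M2 t := (hM t).2.
have cst_g : forall s t, (M s - rise D 0 s)%:~R = (M t - rise D 0 t)%:~R :> R.
  apply: (@locally_constant (fun t => (M t - rise D 0 t)%:~R)) => t.
  apply: near_left_right => //; near=> s; congr (_%:~R).
    have [r1 _] : rise D 0 s = rise D 0 t - jump D t /\ ~ crossing_point D s.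
      by near: s; exact: rise_near_left.
    have h : value_after L s (M t - jump D t) by near: s; exact: value_before_near.
    by rewrite r1 (value_after_uniq (M1 s) h); ring.
  have [r1 _] : rise D 0 s = rise D 0 t /\ ~ crossing_point D s.
    by near: s; exact: rise_near_right.
  have h : value_after L s (M t) by near: s; exact: value_after_near.
  by rewrite r1 (value_after_uniq (M1 s) h).
move=> s t o; have e : rise D s t = M t - M s.
  have /intr_inj := cst_g s t; rewrite (rise_trans D 0 s t).
  by move: (M s) (M t) (rise D 0 s) (rise D s t); clear; lia.
have [_ _ Lx] := hL; rewrite e.
have [[d ->]|[d ->]] := sgnP (or_introl o).
  have [l [[h1 h2] [h3 h4]]] := Lx s t (or_introl o) d.
  by rewrite (value_after_uniq (M1 s) h2) (value_after_uniq (M1 t) h3); ring.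
have [l [[h1 h2] [h3 h4]]] := Lx t s (or_intror o) d.
by rewrite (value_after_uniq (M1 s) h3) (value_after_uniq (M1 t) h2); ring.
Unshelve. all: by end_near. Qed.

End Alexander.
(** * Isotopies and rotations *)

Section Transport.
Context {R : realType}.
Implicit Types (D E : diagram R) (s t : R) (phi : R * R -> R * R).

Definition orientation_preserving phi : Prop :=
  (forall p, differentiable phi p) /\
  forall p, 0 < det2 ('d phi p (1, 0)) ('d phi p (0, 1)).

Lemma det2_linear (f : {linear (R * R)%type -> (R * R)%type}) (u v : R * R) :
  det2 (f u) (f v) = det2 (f (1, 0)) (f (0, 1)) * det2 u v.
Proof.
have key w : f w = w.1 *: f (1, 0) + w.2 *: f (0, 1).
  rewrite -!linearZ -linearD; congr (f _); case: w => a b /=.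
  by congr pair; rewrite /= /GRing.scale /=; ring.
rewrite (key u) (key v) /det2 /=; move: (f _) (f _) => a b.
by rewrite /GRing.scale /=; ring.
Qed.

Lemma det2Z (a b : R) (u v : R * R) : det2 (a *: u) (b *: v) = a * b * det2 u v.
Proof. by rewrite /det2 /= /GRing.scale /=; ring. Qed.

Lemma circle_diffeoDz sigma m t : circle_diffeo sigma ->
  sigma (t + m%:~R) = sigma t + m%:~R :> R.
Proof.
move=> [sP _ _ _]; have h u : sigma (u + 1) - (u + 1) = sigma u - u by rewrite sP; ring.
have := periodic_intr (f := fun u => sigma u - u) h t m => /= e.
by move: e; move: (_%:~R) => z; lra.
Qed.

Lemma circle_diffeo_incr sigma s t : circle_diffeo sigma -> s < t -> sigma s < sigma t :> R.
Proof.
move=> [_ sd _ s0] st; apply: (@gtr0_derive1_lt_cc _ sigma s t) => //.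
  apply/continuous_subspaceT => x; exact/differentiable_continuous/derivable1_diffP.
all: by rewrite in_itv /= lexx ltW.
Qed.

Lemma circle_diffeo_le sigma s t : circle_diffeo sigma -> (sigma s <= sigma t :> R) = (s <= t).
Proof.
move=> sP; case: (leP s t) => [|h]; last by rewrite leNgt circle_diffeo_incr.
by rewrite le_eqVlt => /predU1P[->|h]; [rewrite lexx|rewrite ltW // circle_diffeo_incr].
Qed.

Lemma circle_diffeo_inj sigma : circle_diffeo sigma -> injective (sigma : R -> R).
Proof.
by move=> sP s t e; apply/eqP; rewrite eq_le -(circle_diffeo_le s t sP) -(circle_diffeo_le t s sP) e lexx.
Qed.

Lemma circle_diffeo_surj sigma v : circle_diffeo sigma -> exists t, sigma t = v :> R.
Proof.
move=> sP; pose n := Num.floor (v - sigma 0).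
have /andP[h1 h2] := floor_itv (v - sigma 0); rewrite intrD -/n in h1 h2.
have e1 := circle_diffeoDz n 0 sP; rewrite add0r in e1.
have e2 := circle_diffeoDz (n + 1) 0 sP; rewrite add0r in e2.
have le : n%:~R <= (n + 1)%:~R :> R by rewrite ler_int lerDl.
have [||c _ <-] := @IVT _ sigma n%:~R (n + 1)%:~R v le; last by exists c.
- case: (sP) => _ sd _ _.
  apply/continuous_subspaceT => x; exact/differentiable_continuous/derivable1_diffP.
- rewrite e1 e2 min_l ?max_r ?intrD; lra.
Qed.

(** [sigma] is increasing and commutes with integer shifts, so it preserves the inequalities
    [s + m <= t < s + m + 1] that define the floor. *)
Lemma floor_circle_diffeo sigma s t : circle_diffeo sigma ->
  Num.floor (sigma t - sigma s) = Num.floor (t - s :> R).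
Proof.
move=> sP; have /andP[h1 h2] := floor_itv (t - s); move: h1 h2.
set m := Num.floor (t - s) => h1 h2.
have l1 : sigma (s + m%:~R) <= sigma t by rewrite circle_diffeo_le //; lra.
have l2 : sigma t < sigma (s + (m + 1)%:~R) by rewrite circle_diffeo_incr //; lra.
by move: l1 l2; rewrite !circle_diffeoDz // intrD => l1 l2; apply: floor_unique; lra.
Qed.

Lemma carries_velocity phi sigma D E : (forall p, differentiable phi p) ->
  circle_diffeo sigma -> (forall t, phi (curve D t) = curve E (sigma t)) ->
  forall t, 'd phi (curve D t) (velocity D t) = derive1 sigma t *: velocity E (sigma t).
Proof.
move=> dphi [_ sd _ _] h t.
have dD u : differentiable (curve D) u.
  by apply/derivable1_diffP; case: (diagramP D).
have dE u : differentiable (curve E) u.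
  by apply/derivable1_diffP; case: (diagramP E).
have ds : differentiable sigma t by apply/derivable1_diffP.
have e : phi \o curve D = curve E \o sigma by apply/funext => u /=.
have d1 : differentiable (phi \o curve D) t by exact: differentiable_comp.
have d2 : differentiable (curve E \o sigma) t by exact: differentiable_comp.
have f1 : 'd (phi \o curve D) t 1 = 'd phi (curve D t) (velocity D t).
  by rewrite (diff_comp (dD t) (dphi (curve D t))) /velocity (derive1E' (dD t)).
have f2 : 'd (curve E \o sigma) t 1 = derive1 sigma t *: velocity E (sigma t).
  rewrite (diff_comp ds (dE (sigma t))) /velocity (derive1E' (dE (sigma t))) (derive1E' ds).
  by rewrite -linearZ /= /GRing.scale /= mulr1.
have e1 : derive1 (phi \o curve D) t = derive1 (curve E \o sigma) t := congr1 (fun f : R -> R * R => derive1 f t) e.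
exact (etrans (esym f1) (etrans (esym (derive1E' d1)) (etrans e1 (etrans (derive1E' d2) f2)))).
Qed.

(** The two strands of a crossing share their point of the plane, so both velocities go through the
    same differential, of positive determinant; the reparametrization only contributes positive
    factors. *)
Lemma carries_sgn phi sigma D E : orientation_preserving phi ->
  circle_diffeo sigma -> (forall t, phi (curve D t) = curve E (sigma t)) ->
  forall s t, over_at D s t -> sgn E (sigma s) (sigma t) = sgn D s t.
Proof.
move=> [dphi jphi] sP h s t /over_atP[_ c].
have := carries_velocity dphi sP h s; have := carries_velocity dphi sP h t.
rewrite !sgnE -c; move: (jphi (curve D s)) => j.
case: (sP) => _ _ _ s0; move: (s0 s) (s0 t).
move: (velocity D s) (velocity D t) (velocity E _) (velocity E _) => u v u' v'.
move: (derive1 sigma s) (derive1 sigma t) => a b a0 b0 e1 e2.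
have := det2_linear ('d phi (curve D s)) u v; rewrite e1 e2 det2Z => e3.
suff -> : (0 < det2 u' v') = (0 < det2 u v) by [].
by rewrite -(pmulr_rgt0 (det2 u v) j) -e3 pmulr_rgt0 // mulr_gt0.
Qed.

Lemma carries_rise phi sigma D E : orientation_preserving phi ->
  circle_diffeo sigma -> (forall t, phi (curve D t) = curve E (sigma t)) ->
  (forall s t, over_at D s t <-> over_at E (sigma s) (sigma t)) ->
  forall s t, rise E (sigma s) (sigma t) = rise D s t.
Proof.
(* Crossings are stored with parameters in [[0, 1[], so [sigma] acts on them only after reduction by
   [frac]. The map [g] is a bijection between the two sets of crossings. *)
move=> pphi sP h o s t; pose g (y : R * R) := (frac (sigma y.1), frac (sigma y.2)).
have fs u v : frac u = frac v -> frac (sigma u) = frac (sigma v).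
  by move=> /frac_eqP[m ->]; rewrite circle_diffeoDz // fracDz.
have sf u v : frac (sigma u) = frac (sigma v) -> frac u = frac v.
  move=> /frac_eqP[m]; rewrite -circle_diffeoDz // => /(circle_diffeo_inj sP) ->.
  by rewrite fracDz.
have eE : classical E = [fset g y | y in classical D]%fset.
  apply/fsetP => z; apply/idP/imfsetP => [zE|[y /= yD ->]]; last first.
    by have /o := over_at_classical yD.
  have [h1 h2 _ _] := classical_double (diagramP E) zE.
  have [u hu] := circle_diffeo_surj z.1 sP; have [v hv] := circle_diffeo_surj z.2 sP.
  exists (frac u, frac v).
    by apply/o; rewrite hu hv; apply: over_at_classical.
  rewrite /g /= [LHS]surjective_pairing; congr pair.
    by rewrite -(frac_id h1) -hu; apply: fs; rewrite (frac_id (frac_itv _)).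
  by rewrite -(frac_id h2) -hv; apply: fs; rewrite (frac_id (frac_itv _)).
have gi : {in classical D &, injective g}.
  move=> y z yD zD [/sf e1 /sf e2].
  have [h1 h2 _ _] := classical_double (diagramP D) yD.
  have [h3 h4 _ _] := classical_double (diagramP D) zD.
  rewrite !frac_id // in e1 e2.
  by rewrite [y]surjective_pairing [z]surjective_pairing e1 e2.
rewrite /rise eE big_imfset // !big_seq; apply: eq_bigr => y yD.
rewrite /g /= sgn_frac !cnt_frac (carries_sgn pphi sP h); last exact: over_at_classical.
by rewrite /cnt !floor_circle_diffeo.
Qed.

Lemma carries_manturov phi D E : orientation_preserving phi ->
  carries phi D E -> carries phi (manturov D) (manturov E).
Proof.
move=> pphi [sigma [sP h o]]; exists sigma; split; [exact: sP|exact: h|move=> s t].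
split=> /over_at_manturov[h1 h2]; apply/over_at_manturov.
  split; first exact/o.
  by rewrite (carries_rise pphi sP h o) (carries_sgn pphi sP h).
have h3 := (o s t).2 h1; split; first exact: h3.
by rewrite -(carries_rise pphi sP h o) -(carries_sgn pphi sP h).
Qed.

Lemma planar_isotopy_manturov D E : planar_isotopy D E ->
  planar_isotopy (manturov D) (manturov E).
Proof.
move=> [H HP c]; exists H => //; apply: carries_manturov c.
case: HP => _ /(_ 1) []; rewrite ?lexx ?ler01 // => _ h1 _ h2 _.
Qed.

Lemma rotation_orientation_preserving theta : orientation_preserving (rotation (R := R) theta).
Proof.
have lin : linear (rotation (R := R) theta).
  move=> a [u1 u2] [v1 v2]; rewrite /rotation /= /GRing.scale /=.
  by congr pair; rewrite /GRing.scale /= -[a *: _]/(a * _); ring.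
pose L := GRing.isLinear.Build _ _ _ _ (rotation (R := R) theta) lin.
pose f : {linear (R * R)%type -> (R * R)%type} := HB.pack (rotation theta) L.
have cf : continuous f.
  move=> p; have h1 (a : R) : (fun q : R * R => a * q.1) @ p --> a * p.1.
    by apply: cvgM; [exact: cvg_cst | exact: cvg_fst].
  have h2 (a : R) : (fun q : R * R => a * q.2) @ p --> a * p.2.
    by apply: cvgM; [exact: cvg_cst | exact: cvg_snd].
  exact: (cvg_pair (cvgB (h1 (cos theta)) (h2 (sin theta))) (cvgD (h1 (sin theta)) (h2 (cos theta)))).
split=> p; first exact: (@linear_differentiable _ _ _ f).
rewrite (@diff_lin _ _ _ f) //= /rotation /det2 /=.
by have := cos2Dsin2 theta; rewrite !expr2; lra.
Qed.

(** The projection keeps the curve, and the rotation preserves orientation, so it carries each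
    crossing to one of the same index. *)
Lemma q_periodic_manturov q D : q_periodic q D -> q_periodic q (manturov D).
Proof.
move=> [h c]; split=> //; apply: carries_manturov c.
exact: rotation_orientation_preserving.
Qed.

End Transport.
(** * Strands as graphs *)

Section RootSign.
Context {R : realType}.
Implicit Types (h : R -> R) (x : R).

Lemma same_sign h (a b x y : R) : {within `[a, b], continuous h} ->
  a <= x <= b -> a <= y <= b -> x <= y -> (forall z, x <= z <= y -> h z != 0) ->
  0 < h x * h y.
Proof.
move=> ch hx hy xy nz.
have c : {within `[x, y], continuous h}.
  by apply: continuous_subspaceW ch; apply: subset_itv; rewrite bnd_simp; lra.
rewrite ltNge; apply/negP => le0.
have [|z] := @IVT _ h x y 0 xy c.
  rewrite ge_min le_max; case: (ltgtP (h x) 0) => h1.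
  - by have -> : 0 <= h y by nra.
  - by have -> : h y <= 0 by nra.
  - by have := nz x; rewrite lexx xy h1 eqxx => /(_ isT).
by rewrite in_itv /= => hz; apply/eqP/nz.
Qed.

(** Caratheodory's factorization [h z = g z * (z - x0)], with [g] continuous and [g x0 = d], gives
    the sign of [h] near the simple root [x0]. With no other root up to [x1], this sign persists by
    the intermediate value theorem. *)
Lemma root_sign h (a b x0 x1 d : R) : {within `[a, b], continuous h} ->
  a <= x0 <= b -> a <= x1 <= b -> x0 != x1 -> is_derive x0 1 h d -> d != 0 -> h x0 = 0 ->
  (forall x, (x0 < x <= x1) || (x1 <= x < x0) -> h x != 0) ->
  0 < h x1 * d * (x1 - x0).
Proof.
move=> ch hx0 hx1 ne /is_derive1_caratheodory[g [hg cg gd]] d0 h0 nz.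
have [e /= e0 he] : \forall z \near x0, 0 < g z * d.
  have c : (fun z => g z * d) @ x0 --> g x0 * d.
    by apply: cvgM; [exact: cg | exact: cvg_cst].
  by apply: (cvgr_gt _ c); rewrite gd -expr2 exprn_even_gt0.
(* At distance [r] from [x0], towards [x1], the factorization still decides the sign and [x1] is not
   overshot. *)
pose r := Num.min (e / 2) `|x1 - x0|.
have r0 : 0 < r by rewrite lt_min divr_gt0 //= normr_gt0 subr_eq0 eq_sym.
have re : r < e by rewrite gt_min ltr_pdivrMr // ltr_pMr // ltr1n.
have r1 : r <= `|x1 - x0| by rewrite ge_min lexx orbT.
have key z : `|z - x0| < e -> z != x0 -> 0 < h z * d * (z - x0).
  move=> hz zx; have := hg z; rewrite h0 subr0 => ->.
  have p1 := he z; rewrite /= distrC in p1; have {}p1 := p1 hz.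
  have p2 : 0 < (z - x0) ^+ 2 by rewrite exprn_even_gt0 //= subr_eq0.
  have -> : g z * (z - x0) * d * (z - x0) = g z * d * (z - x0) ^+ 2 by ring.
  exact: mulr_gt0.
case: (ltgtP x0 x1) ne => // lt _.
  rewrite gtr0_norm ?subr_gt0 // in r1.
  have k := key (x0 + r); rewrite (_ : x0 + r - x0 = r) in k; last ring.
  rewrite gtr0_norm // in k; have {}k := k re; have {}k : 0 < h (x0 + r) * d * r by apply: k; lra.
  have s : 0 < h (x0 + r) * h x1.
    apply: (same_sign ch); try lra.
    by move=> z hz; apply: nz; apply/orP; left; lra.
  have x10 : 0 < x1 - x0 by lra.
  rewrite pmulr_lgt0 //; rewrite pmulr_lgt0 // in k.
  by move: (h _) (h _) s k => u v; nra.
rewrite ltr0_norm ?subr_lt0 // in r1.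
have k := key (x0 - r); rewrite (_ : x0 - r - x0 = - r) in k; last ring.
rewrite normrN gtr0_norm // in k; have {}k := k re.
have {}k : 0 < h (x0 - r) * d * - r by apply: k; lra.
have s : 0 < h x1 * h (x0 - r).
  apply: (same_sign ch); try lra.
  by move=> z hz; apply: nz; apply/orP; right; lra.
have x10 : x1 - x0 < 0 by lra.
rewrite nmulr_lgt0 //; rewrite mulrN oppr_gt0 pmulr_llt0 // in k.
by move: (h _) (h _) s k => u v; nra.
Qed.

End RootSign.
Section Strands.
Context {R : realType}.
Implicit Types (D E : diagram R) (a b s t x e : R) (f : R -> R).

Lemma is_derive_curve1 D t : is_derive t 1 (fun u => (curve D u).1) (velocity D t).1.
Proof.
have dD : differentiable (curve D) t by apply/derivable1_diffP; case: (diagramP D).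
have cf : continuous (fst : R * R -> R) by move=> p; exact: cvg_fst.
have df p : differentiable (fst : R * R -> R) p by exact: linear_differentiable.
have d1 : differentiable (fst \o curve D) t by exact: differentiable_comp.
apply: DeriveDef; first by apply/derivable1_diffP.
rewrite -derive1E (derive1E' d1) (diff_comp dD (df _)) (diff_lin _ cf) /=.
by rewrite /velocity (derive1E' dD).
Qed.

Lemma is_derive_curve2 D t : is_derive t 1 (fun u => (curve D u).2) (velocity D t).2.
Proof.
have dD : differentiable (curve D) t by apply/derivable1_diffP; case: (diagramP D).
have cf : continuous (snd : R * R -> R) by move=> p; exact: cvg_snd.
have df p : differentiable (snd : R * R -> R) p by exact: linear_differentiable.
have d1 : differentiable (snd \o curve D) t by exact: differentiable_comp.
apply: DeriveDef; first by apply/derivable1_diffP.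
rewrite -derive1E (derive1E' d1) (diff_comp dD (df _)) (diff_lin _ cf) /=.
by rewrite /velocity (derive1E' dD).
Qed.

Lemma is_derive_continuous (h : R -> R) t d : is_derive t 1 h d -> {for t, continuous h}.
Proof. by move=> [h1 _]; apply/differentiable_continuous/derivable1_diffP. Qed.

(* The strand [a, b] is the graph of f over [-1, 1], run from left to right
   (e = 1) or from right to left (e = -1). *)
Record graph_of D a b e f : Prop := GraphOf {
  graph_dir : e = 1 \/ e = -1;
  graph_ends : (curve D a).1 = - e /\ (curve D b).1 = e;
  graph_vel : forall t, a <= t <= b -> 0 < e * (velocity D t).1;
  graph_mono : forall s t, a <= s -> s < t -> t <= b ->
    0 < e * ((curve D t).1 - (curve D s).1);
  graph_onto : forall x, -1 <= x <= 1 -> exists2 t, a <= t <= b & (curve D t).1 = x;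
  graph_cont : {within `[-1, 1], continuous f};
  graph_val : forall t, a <= t <= b -> f (curve D t).1 = (curve D t).2;
  graph_derive : forall t, a < t < b ->
    is_derive (curve D t).1 1 f ((velocity D t).2 / (velocity D t).1)
}.

(** The abscissa [X] is strictly monotone on [[a, b]], its derivative keeping one sign there; [f] is
    the ordinate [Y] composed with the inverse [g] of [X]. *)
Lemma graph_strandP D a b : a < b -> graph_strand a b D ->
  exists e f, graph_of D a b e f.
Proof.
move=> ab [dir xa xb _]; pose X u := (curve D u).1; pose Y u := (curve D u).2.
have dX (u : R) : is_derive u 1 X (velocity D u).1 := is_derive_curve1 D u.
have dY (u : R) : is_derive u 1 Y (velocity D u).2 := is_derive_curve2 D u.
have [e e1 he] : exists2 e : R, e = 1 \/ e = -1 &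
    forall t, a <= t <= b -> 0 < e * (velocity D t).1.
  case: dir => h; [exists 1|exists (-1)]; auto => t /h; first by rewrite mul1r.
  by rewrite mulN1r oppr_gt0.
have mono s t : a <= s -> s < t -> t <= b -> 0 < e * (X t - X s).
  move=> as_ st tb; have deX (u : R) : is_derive u 1 (fun v => e * X v) (e * (velocity D u).1).
    have h := @is_deriveZ _ _ _ X e u 1 _ (dX u); exact: h.
  have : e * X s < e * X t.
    apply: (@gtr0_derive1_lt_cc _ (fun v => e * X v) a b); rewrite ?in_itv /=; try lra.
    - by move=> u _; case: (deX u).
    - move=> u; rewrite in_itv /= => hu; rewrite derive1E; case: (deX u) => _ ->.
      by apply: he; lra.
    - by apply: continuous_subspaceT => u; exact: is_derive_continuous (deX u).
  by rewrite mulrBr subr_gt0.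
have ends : X a = - e /\ X b = e.
  have n1 (u : R) : `|u| = 1 -> u = 1 \/ u = -1 by case: (ger0P u) => _ h; [left|right]; lra.
  have := mono a b (lexx _) ab (lexx _); rewrite /X.
  by case: (n1 _ xa) => ->; case: (n1 _ xb) => ->; case: e1 => ->; lra.
have cX : continuous X by move=> u; exact: is_derive_continuous (dX u).
(* The default value [a] is only taken outside [[-1, 1]]. *)
pose g x := xget a [set t | a <= t <= b /\ X t = x].
have gK t : a <= t <= b -> g (X t) = t.
  move=> ht; rewrite /g; case: xgetP => [u _ [hu eu]|/(_ t)]; last by case.
  case: (ltgtP u t) => // lt.
    by case/andP: hu => h1 _; case/andP: ht => _ h2; have := mono u t h1 lt h2; rewrite eu subrr mulr0 ltxx.
  by case/andP: ht => h1 _; case/andP: hu => _ h2; have := mono t u h1 lt h2; rewrite eu subrr mulr0 ltxx.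
(* [X] runs from [- e] to [e]; the minimum and maximum recover [[-1, 1]] for both directions. *)
have emin : Num.min (- e) e = -1.
  by case: e1 => ->; rewrite ?opprK; [rewrite min_l|rewrite min_r]; lra.
have emax : Num.max (- e) e = 1.
  by case: e1 => ->; rewrite ?opprK; [rewrite max_r|rewrite max_l]; lra.
have cg : {within `[-1, 1], continuous g}.
  have := @segment_can_continuous _ a b X g (ltW ab).
  move=> /(_ (continuous_subspaceT cX)).
  have c : {in `[a, b], cancel X g} by move=> u; rewrite in_itv /=; exact: gK.
  move=> /(_ c); case: ends => -> ->.
  by rewrite emin emax.
have onto x : -1 <= x <= 1 -> exists2 t, a <= t <= b & X t = x.
  move=> hx; have [|t] := @IVT _ X a b x (ltW ab) (continuous_subspaceT cX).
    case: ends => -> ->.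
    by rewrite emin emax.
  by rewrite in_itv /= => ht <-; exists t.
exists e, (Y \o g); split=> //.
- have cY : continuous Y by move=> u; exact: is_derive_continuous (dY u).
  by move=> x; exact: (cvg_comp _ _ (cg x) (cY (g x))).
- by move=> t ht; rewrite /= gK.
move=> t ht; have v0 : (velocity D t).1 != 0.
  have := he t; rewrite !ltW; [|lra|lra] => /(_ isT).
  by apply: contraTneq => ->; rewrite mulr0 ltxx.
apply: is_derive1_comp; first by rewrite -/(X t) gK ?ltW; try lra; exact: dY.
apply: is_derive_inverse (dX t) v0; last by near=> u; exact: cX.
near=> u; apply: gK; apply/andP; split; apply: ltW; near: u.
  by apply: lt_nbhsr; case/andP: ht.
by apply: lt_nbhsl; case/andP: ht.
Unshelve. all: by end_near. Qed.

Lemma graph_range D a b e f t : a < b -> graph_of D a b e f -> a <= t <= b ->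
  -1 <= (curve D t).1 <= 1.
Proof.
move=> ab g ht; have [xa xb] := graph_ends g; have m := graph_mono g.
have [->|ta] := eqVneq t a.
  by rewrite xa; case: (graph_dir g) => ->; lra.
have [->|tb] := eqVneq t b.
  by rewrite xb; case: (graph_dir g) => ->; lra.
have h1 : 0 < e * ((curve D t).1 - (curve D a).1) by apply: m; rewrite // ?lt_neqAle 1?eq_sym ?ta; lra.
have h2 : 0 < e * ((curve D b).1 - (curve D t).1) by apply: m; rewrite // ?lt_neqAle ?tb; lra.
by move: h1 h2; rewrite xa xb; case: (graph_dir g) => ->; lra.
Qed.

Lemma graph_lt D a b e f s t : graph_of D a b e f -> a <= s <= b -> a <= t <= b ->
  (s < t) = (0 < e * ((curve D t).1 - (curve D s).1)).
Proof.
move=> g /andP[s1 s2] /andP[t1 t2]; case: (ltgtP s t) => [lt|lt|->].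
- by rewrite (graph_mono g).
- by have := graph_mono g t1 lt s2; case: ltP => //; lra.
- by rewrite subrr mulr0 ltxx.
Qed.

Lemma graph_inj D a b e f s t : graph_of D a b e f -> a <= s <= b -> a <= t <= b ->
  (curve D s).1 = (curve D t).1 -> s = t.
Proof.
move=> g hs ht c; apply/eqP; rewrite eq_le !leNgt.
by rewrite (graph_lt g ht hs) (graph_lt g hs ht) c subrr mulr0 ltxx.
Qed.

(** The heights at the right edge are ordinates of end points of strands, which a slide leaves in
    place; this lets [slide_sgn] compare the two diagrams. *)
Lemma graph_end D a b e f : a < b -> graph_of D a b e f ->
  f 1 = (curve D (if e == 1 then b else a)).2.
Proof.
move=> ab g; have [xa xb] := graph_ends g; case: (graph_dir g) => e1.
  by rewrite e1 eqxx -(graph_val g) ?xb ?e1 //; lra.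
rewrite (_ : e == 1 = false); last by rewrite e1; apply/eqP; lra.
by rewrite -(graph_val g) ?xa ?e1 ?opprK //; lra.
Qed.

(* Where the graphs of f and f' cross, (f' - f)' = det2 (velocity s) (velocity t)
   / (x' s * x' t). *)
Lemma crossing_sign D a b e f c d e' f' s t x :
  a < b -> graph_of D a b e f -> graph_of D c d e' f' -> a < s < b -> c < t < d ->
  curve D s = curve D t -> det2 (velocity D s) (velocity D t) != 0 ->
  -1 <= x <= 1 -> x != (curve D s).1 ->
  (forall u w, a <= u <= b -> c <= w <= d -> curve D u = curve D w ->
     ((curve D s).1 < (curve D u).1 <= x) || (x <= (curve D u).1 < (curve D s).1) -> False) ->
  0 < (f' x - f x) * det2 (velocity D s) (velocity D t) * (e * e') * (x - (curve D s).1).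
Proof.
move=> ab g g' hs ht st d0 hx xs nr.
have hs' : a <= s <= b by lra.
have ht' : c <= t <= d by lra.
have rs := graph_range ab g hs'.
have vs := graph_vel g hs'; have vt := graph_vel g' ht'.
have ds := graph_derive g hs; have dt := graph_derive g' ht.
rewrite -st in dt; move: d0 vs vt ds dt; rewrite /det2.
move: (velocity D s) (velocity D t) => [v1 v2] [w1 w2] /= d0 vs vt ds dt.
have v10 : v1 != 0 by apply: contraTneq vs => ->; rewrite mulr0 ltxx.
have w10 : w1 != 0 by apply: contraTneq vt => ->; rewrite mulr0 ltxx.
have dh : is_derive (curve D s).1 1 (f' - f) (w2 / w1 - v2 / v1) by exact: is_deriveB.
have de : w2 / w1 - v2 / v1 = (v1 * w2 - v2 * w1) / (v1 * w1) by field; rewrite v10 w10.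
have ch : {within `[-1, 1], continuous (f' - f)}.
  move=> z; apply: cvgB; [exact: (graph_cont g') | exact: (graph_cont g)].
have := @root_sign _ (f' - f) (-1) 1 (curve D s).1 x _ ch rs hx _ dh.
rewrite eq_sym => /(_ xs); rewrite de => h.
have {}h : 0 < (f' x - f x) * ((v1 * w2 - v2 * w1) / (v1 * w1)) * (x - (curve D s).1).
  apply: h.
  - by rewrite mulf_neq0 // invr_neq0 // mulf_neq0.
  - have e1 : f (curve D s).1 = (curve D s).2 := graph_val g hs'.
    have e2 : f' (curve D s).1 = (curve D s).2 by rewrite st; exact: (graph_val g' ht').
    by rewrite -[LHS]/(f' (curve D s).1 - f (curve D s).1) e1 e2 subrr.
  move=> z hz; apply/eqP => -[]; rewrite -[LHS]/(f' z - f z) => /eqP; rewrite subr_eq0 => /eqP fz.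
  have hz1 : -1 <= z <= 1 by case/orP: hz; move: rs hx; lra.
  have [u hu uz] := graph_onto g hz1; have [w hw wz] := graph_onto g' hz1.
  apply: (nr u w hu hw); last by rewrite uz.
  rewrite [LHS]surjective_pairing [RHS]surjective_pairing uz wz.
  by rewrite -(graph_val g hu) -(graph_val g' hw) uz wz fz.
have p : 0 < (e * v1) * (e' * w1) by rewrite mulr_gt0.
have := mulr_gt0 h p; congr (0 < _); field.
by rewrite v10 w10.
Qed.

End Strands.
(** * Local moves *)

Section Windows.
Context {R : realType}.
Implicit Types (D E : diagram R) (s t : R).

Lemma not_in_arc_itv (a b t : R) : a < b < a + 1 ->
  ~ in_arc a b t <-> exists m : int, b + m%:~R < t < a + 1 + m%:~R.
Proof.
move=> ab; split=> [h|[m hm] [k hk]].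
  have /andP[h1 h2] := floor_itv (t - a); rewrite intrD in h2.
  exists (Num.floor (t - a)); apply/andP; split; last lra.
  rewrite ltNge; apply/negP => h3; apply: h; exists (- Num.floor (t - a)).
  by rewrite mulrNz; lra.
have [km|km|km] := ltgtP (m + k) 0.
- have : m + k <= -1 by lia.
  by rewrite -(ler_int R) intrD mulrN1z; move: hm hk ab; lra.
- have : 1 <= m + k by lia.
  by rewrite -(ler_int R) intrD mulr1z; move: hm hk ab; lra.
- have : (m + k)%:~R = 0 :> R by rewrite km.
  by rewrite intrD; move: hm hk ab; lra.
Qed.

Lemma near_not_in_arc (a b t : R) : a < b < a + 1 -> ~ in_arc a b t ->
  \forall u \near t, ~ in_arc a b u.
Proof.
move=> ab /(not_in_arc_itv t ab)[m /andP[h1 h2]].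
near=> u; apply/(not_in_arc_itv u ab); exists m; apply/andP; split; near: u.
  exact: lt_nbhsr.
exact: lt_nbhsl.
Unshelve. all: by end_near. Qed.

Section Reroute.
Context (a b : R) (D E : diagram R).
Hypothesis rDE : reroute a b D E.

Lemma reroute_velocity t : ~ in_arc a b t -> velocity E t = velocity D t.
Proof.
case: rDE => ab h _ ht; rewrite /velocity !derive1E; apply: near_eq_derive.
by apply: filterS (near_not_in_arc ab ht) => u; exact: h.
Qed.

Lemma reroute_sgn s t : ~ in_arc a b s -> ~ in_arc a b t -> sgn E s t = sgn D s t.
Proof. by move=> hs ht; rewrite !sgnE !reroute_velocity. Qed.

Lemma curve_continuous D' : continuous (curve D').
Proof.
move=> u; apply/differentiable_continuous/derivable1_diffP; by case: (diagramP D').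
Qed.

(** The curves are given as equal only off the closed arc. They agree on the gap []b - 1, a[] that
    precedes it, hence at [a] by continuity. *)
Lemma reroute_left : curve E a = curve D a.
Proof.
case: rDE => ab h _.
have e : \forall u \near a^'-, curve D u = curve E u.
  apply/near_leftE; exists (b - 1); first lra.
  move=> u hu; rewrite h //; apply/(not_in_arc_itv u ab); exists (-1).
  by rewrite mulrN1z; lra.
have c1 : curve E u @[u --> a^'-] --> curve E a.
  exact/cvg_at_left_filter/curve_continuous.
have c2 : curve D u @[u --> a^'-] --> curve D a.
  exact/cvg_at_left_filter/curve_continuous.
have c3 : curve E u @[u --> a^'-] --> curve D a.
  by apply: cvg_trans c2; apply: near_eq_cvg.
exact: (cvg_unique _ c1 c3).
Qed.

Lemma reroute_right : curve E b = curve D b.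
Proof.
case: rDE => ab h _.
have e : \forall u \near b^'+, curve D u = curve E u.
  apply/near_rightE; exists (a + 1); first lra.
  move=> u hu; rewrite h //; apply/(not_in_arc_itv u ab); exists 0.
  by rewrite mulr0z; lra.
have c1 : curve E u @[u --> b^'+] --> curve E b.
  exact/cvg_at_right_filter/curve_continuous.
have c2 : curve D u @[u --> b^'+] --> curve D b.
  exact/cvg_at_right_filter/curve_continuous.
have c3 : curve E u @[u --> b^'+] --> curve D b.
  by apply: cvg_trans c2; apply: near_eq_cvg.
exact: (cvg_unique _ c1 c3).
Qed.

End Reroute.

Definition inner (k : nat) (a b : 'I_k -> R) t : bool := `[< exists i, in_arc (a i) (b i) t >].

Lemma innerP k (a b : 'I_k -> R) t : reflect (exists i, in_arc (a i) (b i) t) (inner a b t).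
Proof. exact: asboolP. Qed.

Lemma inner_frac k (a b : 'I_k -> R) t : inner a b (frac t) = inner a b t.
Proof. by apply/innerP/innerP => -[i h]; exists i; apply/in_arc_frac. Qed.

Lemma inner_self k (a b : 'I_k -> R) i t : a i <= t <= b i -> inner a b t.
Proof. by move=> h; apply/innerP; exists i; exact: in_arc_self. Qed.

(** Being in the window is thus a property of the point of the plane, not of the parameter; so the
    two strands of a crossing are both inside or both outside ([window_over]). At the ends of an
    arc, the bound follows by continuity. *)
Lemma window_norm k (a b : 'I_k -> R) D t : in_window a b D ->
  (`|curve D t| <= 1) = inner a b t.
Proof.
move=> [ab _ hin hout]; apply/idP/innerP => [h|[i [m hm]]].
  apply: contrapT => n; have : 1 < `|curve D t|.
    by apply: hout => i hi; apply: n; exists i.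
  by rewrite ltNge h.
have abi := ab i; rewrite -(curveDz D t m); move: hm; set u := t + _ => hu.
rewrite leNgt; apply/negP => h.
have : \forall v \near u, 1 < `|curve D v|.
  have c : (fun v => `|curve D v|) @ u --> `|curve D u|.
    by apply: cvg_norm; exact: curve_continuous.
  exact: (cvgr_gt _ c).
have [ub|ub] := ltP u (b i).
  move=> n; have : \forall v \near u^'+, 1 < `|curve D v| by exact: cvg_within n.
  (* A point of the open arc just after [u], where the norm would be both above and below 1. For [u]
     at the right end, the left side is used instead. *)
  move=> /near_rightE[e ue he]; pose v := (u + Num.min e (b i)) / 2.
  have [h1 h2] : u < Num.min e (b i) /\ Num.min e (b i) <= b i.
    by rewrite lt_min ue ub ge_min lexx orbT.
  have h3 : Num.min e (b i) <= e by rewrite ge_min lexx.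
  have k1 : u < v < e by rewrite /v; lra.
  have k2 : a i < v < b i by rewrite /v; lra.
  by have := he v k1; have := hin i v k2; lra.
move=> n; have : \forall v \near u^'-, 1 < `|curve D v| by exact: cvg_within n.
move=> /near_leftE[e ue he]; pose v := (u + Num.max e (a i)) / 2.
have [h1 h2] : Num.max e (a i) < u /\ a i <= Num.max e (a i).
  by rewrite gt_max ue le_max lexx orbT; split=> //; lra.
have h3 : e <= Num.max e (a i) by rewrite le_max lexx.
have k1 : e < v < u by rewrite /v; lra.
have k2 : a i < v < b i by rewrite /v; lra.
by have := he v k1; have := hin i v k2; lra.
Qed.

Lemma window_over k (a b : 'I_k -> R) D s t : in_window a b D ->
  over_at D s t -> inner a b s = inner a b t.
Proof. by move=> w /over_atP[_ e]; rewrite -!(window_norm _ w) e. Qed.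

Lemma in_arc_uniq k (a b : 'I_k -> R) D i j t : in_window a b D ->
  in_arc (a i) (b i) t -> in_arc (a j) (b j) t -> i = j.
Proof. by move=> [_ h _ _] h1 h2; apply/eqP/negP => /negP n; exact: (h i j t n h1 h2). Qed.

End Windows.

(** * Contributions from inside and outside a window *)

Section Tangles.
Context {R : realType}.
Implicit Types (D E : diagram R) (s t : R) (r : seq (R * R)).

Definition frac2 (y : R * R) := (frac y.1, frac y.2).

Definition local_rise D r s t : int :=
  \sum_(y <- r) sgn D y.1 y.2 * (cnt y.2 s t - cnt y.1 s t).

Lemma rise_congr D s s' t t' : frac s = frac s' -> frac t = frac t' ->
  rise D s t = rise D s' t'.
Proof. by move=> h1 h2; rewrite -rise_frac h1 h2 rise_frac. Qed.

Lemma sgn_congr D s s' t t' : frac s = frac s' -> frac t = frac t' ->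
  sgn D s t = sgn D s' t'.
Proof. by move=> h1 h2; rewrite -sgn_frac h1 h2 sgn_frac. Qed.

Lemma over_at_congr D s s' t t' : frac s = frac s' -> frac t = frac t' ->
  over_at D s t = over_at D s' t'.
Proof. by rewrite /over_at => -> ->. Qed.

Lemma same_over_rise D E : (forall s t, over_at E s t <-> over_at D s t) ->
  (forall s t, over_at D s t -> sgn E s t = sgn D s t) ->
  forall s t, rise E s t = rise D s t.
Proof.
move=> o g s t; have e : classical E = classical D.
  apply/fsetP => y; apply/idP/idP => yX.
    have [h1 h2 _ _] := classical_double (diagramP E) yX.
    have /o := over_at_classical yX.
    by rewrite /over_at !frac_id // -surjective_pairing.
  have [h1 h2 _ _] := classical_double (diagramP D) yX.
  have /o := over_at_classical yX.
  by rewrite /over_at !frac_id // -surjective_pairing.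
rewrite /rise e !big_seq; apply: eq_bigr => y yX.
by rewrite g //; exact: over_at_classical.
Qed.

(** All classical crossings avoid the rerouted arc on both sides, so the two diagrams have the same
    crossings with the same signs, and therefore the same indices. *)
Lemma detour_manturov D E : detour D E -> detour (manturov D) (manturov E).
Proof.
move=> [a [b [rDE vD vE]]]; case: (rDE) => ab hc ho.
have o s t : over_at E s t <-> over_at D s t.
  by split=> h; [have [h1 h2] := vE _ _ h | have [h1 h2] := vD _ _ h]; apply/ho.
have g s t : over_at D s t -> sgn E s t = sgn D s t.
  by move=> /vD[h1 h2]; exact: (reroute_sgn rDE).
have m s t : over_at (manturov E) s t <-> over_at (manturov D) s t.
  split=> /over_at_manturov[h1 h2]; apply/over_at_manturov; have h3 := h1.
    by move/o in h3; split=> //; rewrite -(g _ _ h3) -(same_over_rise o g).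
  by move/o in h3; split=> //; rewrite (g _ _ h1) (same_over_rise o g).
exists a, b; split.
- by split=> [//|//|s t _ _]; exact: m.
- by move=> s t /over_at_manturov[/vD].
- by move=> s t /over_at_manturov[/vE].
Qed.

Section Window.
Context (k : nat) (a b : 'I_k -> R).

Definition outer_rise D s t : int :=
  \sum_(y <- classical D | ~~ inner a b y.1) sgn D y.1 y.2 * (cnt y.2 s t - cnt y.1 s t).

(* r lists, up to integer shifts of the parameters, the classical crossings inside the window *)
Definition inventory D r : Prop :=
  [/\ in_window a b D, uniq (map frac2 r),
      forall y, y \in r -> over_at D y.1 y.2 /\ inner a b y.1
    & forall s t, over_at D s t -> inner a b s -> frac2 (s, t) \in map frac2 r].

Definition same_outside D E : Prop :=
  forall s t, ~~ inner a b s -> ~~ inner a b t ->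
    (over_at E s t <-> over_at D s t) /\ sgn E s t = sgn D s t.

Lemma rise_inventory D r s t : inventory D r ->
  rise D s t = outer_rise D s t + local_rise D r s t.
Proof.
move=> [w ur hr hD]; rewrite /rise (bigID (fun y => inner a b y.1)) /= addrC; congr (_ + _).
rewrite -big_filter (perm_big (map frac2 r)) /=.
  rewrite big_map; apply: eq_bigr => y _ /=.
  by rewrite sgn_frac !cnt_frac.
apply: uniq_perm; rewrite ?filter_uniq ?fset_uniq // => y; rewrite mem_filter.
apply/andP/mapP => [[yi yD]|[z zr ->]].
  have [h1 h2 _ _] := classical_double (diagramP D) yD.
  have /mapP[z zr e] := hD _ _ (over_at_classical yD) yi.
  by exists z => //; rewrite -e /frac2 /= !frac_id // -surjective_pairing.
by have [ov yi] := hr z zr; rewrite /frac2 /= inner_frac.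
Qed.

Lemma outer_rise_eq D E s t : in_window a b D -> in_window a b E ->
  same_outside D E -> outer_rise E s t = outer_rise D s t.
Proof.
move=> wD wE so; rewrite /outer_rise -[LHS]big_filter -[RHS]big_filter.
have hio F y : in_window a b F -> y \in classical F -> ~~ inner a b y.1 ->
    over_at F y.1 y.2 /\ ~~ inner a b y.2.
  by move=> w yD n; have o := over_at_classical yD; rewrite -(window_over w o).
have cl F y : y \in classical F -> over_at D y.1 y.2 -> y \in classical D.
  move=> yD; have [h1 h2 _ _] := classical_double (diagramP F) yD.
  by rewrite /over_at !frac_id // -surjective_pairing.
have cl' F y : y \in classical F -> over_at E y.1 y.2 -> y \in classical E.
  move=> yD; have [h1 h2 _ _] := classical_double (diagramP F) yD.
  by rewrite /over_at !frac_id // -surjective_pairing.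
rewrite (perm_big [seq y <- classical D | ~~ inner a b y.1]) /=.
  rewrite !big_seq; apply: eq_bigr => y; rewrite mem_filter => /andP[n yD].
  have [_ n2] := hio D y wD yD n; by have [_ ->] := so _ _ n n2.
apply: uniq_perm; rewrite ?filter_uniq ?fset_uniq // => y; rewrite !mem_filter.
case n : (inner a b y.1) => //=; move/negbT in n; apply/idP/idP => yX.
  by have [ov n2] := hio E y wE yX n; apply: (cl E) => //; apply/(so _ _ n n2).1.
by have [ov n2] := hio D y wD yX n; apply: (cl' D) => //; apply/(so _ _ n n2).1.
Qed.

(** A crossing outside the window has no parameter on its strands, so sliding the two ends of the
    path along their strands passes no jump. *)
Lemma outer_rise_strand D i j s s' t t' : in_window a b D ->
  a i <= s <= b i -> a i <= s' <= b i -> a j <= t <= b j -> a j <= t' <= b j ->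
  outer_rise D s t = outer_rise D s' t'.
Proof.
move=> w hs hs' ht ht'; rewrite /outer_rise big_seq_cond [RHS]big_seq_cond.
apply: eq_bigr => y /andP[yD n]; have o := over_at_classical yD.
have n2 : ~~ inner a b y.2 by rewrite -(window_over w o).
have na l z : ~~ inner a b z -> ~ in_arc (a l) (b l) z by move=> /innerP h1 h2; apply: h1; exists l.
rewrite /cnt (floor_arc_r ht ht' (na j _ n)) (floor_arc_r ht ht' (na j _ n2)).
by rewrite (floor_arc_r hs hs' (na i _ n)) (floor_arc_r hs hs' (na i _ n2)).
Qed.

Lemma outer_rise_id D s : outer_rise D s s = 0.
Proof. by rewrite /outer_rise big1 // => y _; rewrite /cnt !subrr mulr0. Qed.

Lemma rise_strand D r i s t : inventory D r -> a i <= s <= b i -> a i <= t <= b i ->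
  rise D s t = local_rise D r s t.
Proof.
move=> inv hs ht; have [w _ _ _] := inv; rewrite (rise_inventory _ _ inv).
by rewrite (outer_rise_strand w hs hs ht hs) outer_rise_id add0r.
Qed.

Lemma manturov_outside D E rD rE : inventory D rD -> inventory E rE -> same_outside D E ->
  (forall s t, ~~ inner a b s -> ~~ inner a b t ->
     local_rise E rE s t = local_rise D rD s t) ->
  forall s t, ~~ inner a b s -> ~~ inner a b t ->
    (over_at (manturov E) s t <-> over_at (manturov D) s t).
Proof.
move=> iD iE so lr s t hs ht; have [wD _ _ _] := iD; have [wE _ _ _] := iE.
have [ov g] := so s t hs ht.
have e : rise E s t = rise D s t.
  by rewrite (rise_inventory _ _ iE) (rise_inventory _ _ iD) (outer_rise_eq _ _ wD wE so) lr.
split=> /over_at_manturov[h1 h2]; apply/over_at_manturov.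
  by split; [exact/ov | rewrite -e -g].
by split; [exact/ov | rewrite e g].
Qed.

Lemma reroute_same_outside i D E : reroute (a i) (b i) D E -> same_outside D E.
Proof.
move=> rr s t hs ht; have na z : ~~ inner a b z -> ~ in_arc (a i) (b i) z.
  by move=> /innerP h1 h2; apply: h1; exists i.
by split; [case: rr => _ _; apply; apply: na | apply: (reroute_sgn rr); apply: na].
Qed.

Lemma inner_lift s : inner a b s -> exists i s', a i <= s' <= b i /\ frac s' = frac s.
Proof.
by move=> /innerP[i [m h]]; exists i, (s + m%:~R); split=> //; rewrite fracDz.
Qed.

Lemma window_lift D s t : in_window a b D -> over_at D s t -> inner a b s ->
  exists i j s' t', [/\ a i <= s' <= b i, a j <= t' <= b j,
    frac s' = frac s, frac t' = frac t & curve D s' = curve D t'].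
Proof.
move=> w o hs; have ht : inner a b t by rewrite -(window_over w o).
have [i [s' [hs' es]]] := inner_lift hs; have [j [t' [ht' et]]] := inner_lift ht.
exists i, j, s', t'; split=> //.
by have [_ e] := over_atP o; rewrite -(curve_frac D s') es -(curve_frac D t') et !curve_frac.
Qed.

(** An arc is shorter than a full turn, so the difference lies in []-1, 1[] and its floor only
    records the order. *)
Lemma floor_same_arc i s t : a i < b i < a i + 1 -> a i <= s <= b i -> a i <= t <= b i ->
  Num.floor (s - t) = - (s < t)%R%:Z.
Proof.
move=> ab hs ht; have [h|h] := ltP s t.
  by apply: floor_unique; rewrite mulrN1z; lra.
by apply: floor_unique; rewrite oppr0 mulr0z; lra.
Qed.

Lemma frac_same_arc i s t : a i < b i < a i + 1 -> a i <= s <= b i -> a i <= t <= b i ->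
  frac s = frac t -> s = t.
Proof.
move=> ab hs ht /frac_eqP[m e]; have [m1|m1|m0] := ltgtP m 0.
- have : m <= -1 by lia.
  by rewrite -(ler_int R) mulrN1z; move: e; lra.
- have : 1 <= m by lia.
  by rewrite -(ler_int R) mulr1z; move: e; lra.
- by rewrite e m0 addr0.
Qed.

Lemma frac_arc_neq D i j s t : in_window a b D -> i != j ->
  a i <= s <= b i -> a j <= t <= b j -> frac s != frac t.
Proof.
move=> w ij hs ht; apply/eqP => e; case/negP: ij; apply/eqP.
apply: (in_arc_uniq w (t := s)); first exact: in_arc_self.
by apply/in_arc_frac; rewrite e; apply/in_arc_frac; exact: in_arc_self.
Qed.

End Window.
End Tangles.
(** * First and second moves *)

Section FirstSecondMoves.
Context {R : realType}.
Implicit Types (D E : diagram R) (s t p q : R).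

(** Between points outside the window, a path passes [p] and [q] equally often, and their jumps are
    opposite. *)
Lemma local_rise_kink k (a b : 'I_k -> R) E i p q s t :
  a i <= p <= b i -> a i <= q <= b i -> ~~ inner a b s -> ~~ inner a b t ->
  local_rise E [:: (p, q)] s t = 0.
Proof.
move=> hp hq hs ht; rewrite /local_rise big_seq1 /cnt /=.
have na z : ~~ inner a b z -> ~ in_arc (a i) (b i) z by move=> /innerP h1 h2; apply: h1; exists i.
by rewrite (floor_arc hp hq (na _ hs)) (floor_arc hp hq (na _ ht)) subrr mulr0.
Qed.

(** The loop of the kink meets no other classical crossing. Whether it is run forwards to the head
    [q] or backwards from the tail [p], the only jump counted equals the sign, so the index is 0. *)
Lemma rise_kink k (a b : 'I_k -> R) E i p q : inventory a b E [:: (p, q)] ->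
  a i <= p <= b i -> a i <= q <= b i -> p != q -> rise E p q = sgn E p q.
Proof.
move=> inv hp hq pq; have [[ab _ _ _] _ _ _] := inv.
rewrite (rise_strand inv hp hq) /local_rise big_seq1 /cnt /=.
rewrite !(floor_same_arc (ab i)) // !ltxx.
by case: (ltgtP p q) pq => //= _ _; rewrite ?oppr0 ?opprK ?subr0 ?sub0r ?addr0 ?opprK mulr1.
Qed.

Lemma reidemeister1_manturov D E : reidemeister1 D E ->
  reidemeister1 (manturov D) (manturov E).
Proof.
move=> [a [b]] /= [wD wE rr injD [s0 [t0 [hst eE ov]]]].
have [ab _ _ _] := wD.
have hs : a ord0 <= s0 <= b ord0 by lra.
have ht : a ord0 <= t0 <= b ord0 by lra.
have st : s0 != t0 by rewrite lt_eqF //; case: hst => _ /andP[].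
have iD : inventory a b D [::].
  split=> // s t o hi; have [i [j [s' [t' [h1 h2 e1 e2 c]]]]] := window_lift wD o hi.
  have [/eqP n _] := over_atP o; case: n; rewrite -e1 -e2; congr frac.
  by apply: injD c; [rewrite (ord1 i) in h1 | rewrite (ord1 j) in h2].
(* Both choices of the upper strand are treated at once, [p] being the over-parameter. *)
have key : forall p q, (p, q) = (s0, t0) \/ (p, q) = (t0, s0) -> over_at E p q ->
    inventory a b E [:: (p, q)].
  move=> p q pq o; split=> //.
    move=> y; rewrite inE => /eqP -> /=; split=> //.
    by apply: (@inner_self _ _ a b ord0); case: pq => -[-> _].
  move=> s t o' hi; have [i [j [s' [t' [h1 h2 e1 e2 c]]]]] := window_lift wE o' hi.
  rewrite (ord1 i) in h1; rewrite (ord1 j) in h2.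
  have [n _] := over_atP o'; rewrite -e1 -e2 in n.
  have o'' : over_at E s' t' by rewrite (over_at_congr _ e1 e2).
  have : (s', t') = (s0, t0) \/ (s', t') = (t0, s0).
    case/andP: h1 => a1 b1; case/andP: h2 => a2 b2.
    case: (ltgtP s' t') => lt; last by rewrite lt eqxx in n.
      by have [-> ->] := (eE s' t' a1 lt b2).1 c; left.
    by have [-> ->] := (eE t' s' a2 lt b1).1 (esym c); right.
  move=> st'; rewrite inE /frac2 /= -e1 -e2; apply/eqP.
  case: pq st' => -[? ?] [] [? ?]; subst => //.
    by case: (over_at_asym o).
  by case: (over_at_asym o).
exists a, b => /=; split; [exact: wD | exact: wE | | exact: injD |]; last first.
  exists s0, t0; split; [exact: hst | exact: eE |].
  case: ov => ov; [left|right]; apply/over_at_manturov; (split; first exact: ov).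
    by apply: (rise_kink (i := ord0) (key _ _ _ ov)) => //; left.
  by apply: (rise_kink (i := ord0) (key _ _ _ ov)) => //; [right | rewrite eq_sym].
case: (rr) => abr hc _; split; [exact: abr | exact: hc | move=> s t ns nt].
have out u : ~ in_arc (a ord0) (b ord0) u -> ~~ inner a b u.
  by move=> n; apply/innerP => -[i]; rewrite (ord1 i).
have so := reroute_same_outside rr.
case: ov => ov.
  apply: (manturov_outside iD (key s0 t0 (or_introl erefl) ov) so) => [u v hu hv||];
    [|exact: out|exact: out].
  by rewrite (local_rise_kink _ hs ht) // /local_rise big_nil.
apply: (manturov_outside iD (key t0 s0 (or_intror erefl) ov) so) => [u v hu hv||];
  [|exact: out|exact: out].
by rewrite (local_rise_kink _ ht hs) // /local_rise big_nil.
Qed.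

(** Follow [p1], [p2], [q2], [q1]. As the signs are opposite, each of the two sides of the bigon
    contributes [sgn E p1 q1], whatever the order of the crossings on it; the total is the
    difference of the signs. *)
Lemma rise_bigon k (a b : 'I_k -> R) E i j p1 q1 p2 q2 :
  inventory a b E [:: (p1, q1); (p2, q2)] -> i != j ->
  a i <= p1 <= b i -> a i <= p2 <= b i -> a j <= q1 <= b j -> a j <= q2 <= b j ->
  p1 != p2 -> q1 != q2 -> sgn E p2 q2 = - sgn E p1 q1 ->
  rise E p1 q1 - sgn E p1 q1 = rise E p2 q2 - sgn E p2 q2.
Proof.
move=> inv ij hp1 hp2 hq1 hq2 pp qq g; have [w _ _ _] := inv; have [ab _ _ _] := w.
have nij z : a j <= z <= b j -> ~ in_arc (a i) (b i) z.
  by move=> h1 h2; move: ij; rewrite (in_arc_uniq w h2 (in_arc_self h1)) eqxx.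
have nji z : a i <= z <= b i -> ~ in_arc (a j) (b j) z.
  by move=> h1 h2; move: ij; rewrite (in_arc_uniq w h2 (in_arc_self h1)) eqxx.
have r1 : rise E p1 p2 = sgn E p1 q1.
  rewrite (rise_strand inv hp1 hp2) /local_rise big_cons big_seq1 /= g.
  rewrite (cnt_in_arc hp1 hp2 (nij _ hq1)) (cnt_in_arc hp1 hp2 (nij _ hq2)) /cnt !(floor_same_arc (ab i)) // !ltxx.
  by case: (ltgtP p1 p2) pp => //= _ _; ring.
have r2 : rise E q2 q1 = sgn E p1 q1.
  rewrite (rise_strand inv hq2 hq1) /local_rise big_cons big_seq1 /= g.
  rewrite (cnt_in_arc hq2 hq1 (nji _ hp1)) (cnt_in_arc hq2 hq1 (nji _ hp2)) /cnt !(floor_same_arc (ab j)) // !ltxx.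
  by case: (ltgtP q1 q2) qq => //= _ _; ring.
rewrite (rise_trans E p1 p2 q1) (rise_trans E p2 q2 q1) r1 r2 g; ring.
Qed.

Lemma local_rise_bigon k (a b : 'I_k -> R) E i j p1 q1 p2 q2 s t :
  a i <= p1 <= b i -> a i <= p2 <= b i -> a j <= q1 <= b j -> a j <= q2 <= b j ->
  sgn E p2 q2 = - sgn E p1 q1 -> ~~ inner a b s -> ~~ inner a b t ->
  local_rise E [:: (p1, q1); (p2, q2)] s t = 0.
Proof.
move=> hp1 hp2 hq1 hq2 g hs ht; rewrite /local_rise big_cons big_seq1 /= g /cnt.
have na l z : ~~ inner a b z -> ~ in_arc (a l) (b l) z by move=> /innerP h1 h2; apply: h1; exists l.
rewrite (floor_arc hp1 hp2 (na i _ hs)) (floor_arc hp1 hp2 (na i _ ht)).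
by rewrite (floor_arc hq1 hq2 (na j _ hs)) (floor_arc hq1 hq2 (na j _ ht)); ring.
Qed.

Lemma itv_oo_cc (x y z : R) : x < z < y -> x <= z <= y.
Proof. by move=> /andP[/ltW-> /ltW->]. Qed.

Lemma ord2P (i : 'I_2) : i = ord0 \/ i = ord_max.
Proof. by case: i => [[|[|//]] h]; [left|right]; apply: val_inj. Qed.

Lemma opposite_signs (h x y w z : R) :
  0 < h * x * w * z -> 0 < h * y * w * - z ->
  (if 0 < y then 1 else -1 : int) = - (if 0 < x then 1 else -1).
Proof.
move=> k1 k2; have xy : x * y < 0.
  rewrite ltNge; apply/negP => xy.
  have := mulr_gt0 k1 k2.
  have -> : h * x * w * z * (h * y * w * - z) = - (x * y * (h * w * z) ^+ 2) by ring.
  by rewrite oppr_gt0 ltNge mulr_ge0 // sqr_ge0.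
by have [x1|x1] := ltP 0 x; have [y1|y1] := ltP 0 y => //; exfalso; move: xy; clear -x1 y1; nra.
Qed.

(** At the midpoint [m] of the two abscissae, the height difference of the graphs is reached from
    one root on the left and one on the right, with no root between. So its derivatives at the two
    roots have opposite signs, while the directions of the strands are common. *)
Lemma bigon_sgn E a b c d s1 s2 t1 t2 : a < b -> c < d ->
  graph_strand a b E -> graph_strand c d E ->
  a < s1 < b -> a < s2 < b -> c < t1 < d -> c < t2 < d -> s1 != s2 ->
  (forall s t, a <= s <= b -> c <= t <= d ->
     (curve E s = curve E t <-> (s = s1 /\ t = t1) \/ (s = s2 /\ t = t2))) ->
  det2 (velocity E s1) (velocity E t1) != 0 -> det2 (velocity E s2) (velocity E t2) != 0 ->
  sgn E s2 t2 = - sgn E s1 t1.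
Proof.
move=> ab cd /(graph_strandP ab)[e [f g]] /(graph_strandP cd)[e' [f' g']].
move=> hs1 hs2 ht1 ht2 ss cr.
have ws1 := itv_oo_cc hs1; have ws2 := itv_oo_cc hs2.
have wt1 := itv_oo_cc ht1; have wt2 := itv_oo_cc ht2.
have c1 : curve E s1 = curve E t1 by apply/cr => //; left.
have c2 : curve E s2 = curve E t2 by apply/cr => //; right.
have r1 := graph_range ab g ws1; have r2 := graph_range ab g ws2.
have X12 : (curve E s1).1 != (curve E s2).1.
  by apply: contra_neq ss => h; apply: graph_inj g ws1 ws2 h.
pose m := ((curve E s1).1 + (curve E s2).1) / 2.
have hm : -1 <= m <= 1 by rewrite /m; lra.
have m1 : m != (curve E s1).1 by apply: contra_neq X12; rewrite /m; lra.
have m2 : m != (curve E s2).1 by apply: contra_neq X12; rewrite /m; lra.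
have m12 : m - (curve E s2).1 = - (m - (curve E s1).1) by rewrite /m; lra.
have n1 : forall u w, a <= u <= b -> c <= w <= d -> curve E u = curve E w ->
    ((curve E s1).1 < (curve E u).1 <= m) || (m <= (curve E u).1 < (curve E s1).1) -> False.
  by move=> u w hu hw /(cr u w hu hw)[] [-> _]; move: X12; rewrite /m neq_lt; lra.
have n2 : forall u w, a <= u <= b -> c <= w <= d -> curve E u = curve E w ->
    ((curve E s2).1 < (curve E u).1 <= m) || (m <= (curve E u).1 < (curve E s2).1) -> False.
  by move=> u w hu hw /(cr u w hu hw)[] [-> _]; move: X12; rewrite /m neq_lt; lra.
move=> d1 d2.
have k1 := crossing_sign ab g g' hs1 ht1 c1 d1 hm m1 n1.
have k2 := crossing_sign ab g g' hs2 ht2 c2 d2 hm m2 n2.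
by rewrite m12 in k2; rewrite !sgnE; exact: opposite_signs k1 k2.
Qed.

Lemma manturov_virtual k (a b : 'I_k -> R) D r s t : inventory a b D r ->
  (forall y, y \in r -> rise D y.1 y.2 != sgn D y.1 y.2) ->
  over_at (manturov D) s t -> ~~ inner a b s /\ ~~ inner a b t.
Proof.
move=> inv odd /over_at_manturov[ov e]; have [w _ _ hr] := inv.
rewrite -(window_over w ov); suff : ~~ inner a b s by [].
apply/negP => hi; have /mapP[y yr [e1 e2]] := hr s t ov hi.
by have /eqP := odd y yr; apply; rewrite -(rise_congr D e1 e2) -(sgn_congr D e1 e2).
Qed.

Lemma not_inner k (a b : 'I_k -> R) i t : ~~ inner a b t -> ~ in_arc (a i) (b i) t.
Proof. by move=> /innerP h1 h2; apply: h1; exists i. Qed.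

Lemma reidemeister2_manturov D E : reidemeister2 D E ->
  reidemeister2 (manturov D) (manturov E) \/ detour (manturov D) (manturov E).
Proof.
move=> [a [b]] /=; set i0 : 'I_2 := ord0; set i1 : 'I_2 := ord_max.
move=> [[wD wE] gDE rr dis [s1 [s2 [t1 [t2 [ss [hs1 hs2 ht1 ht2] cr ov]]]]]].
have [ab _ _ _] := wD; have so := reroute_same_outside rr.
have abl i : a i < b i by have := ab i; lra.
have inj F i s t : graph_strand (a i) (b i) F -> a i <= s <= b i -> a i <= t <= b i ->
    curve F s = curve F t -> s = t.
  by move=> /(graph_strandP (abl i))[e [f g]] h1 h2 c; apply: (graph_inj g h1 h2); rewrite c.
have iD : inventory a b D [::].
  split=> // s t o hi; have [i [j [s' [t' [h1 h2 e1 e2 c]]]]] := window_lift wD o hi.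
  have [/eqP n _] := over_atP o; case: n; rewrite -e1 -e2; congr frac.
  case: (ord2P i) (ord2P j) => ei [] ej; subst i j.
  - exact: inj (gDE _).1 h1 h2 c.
  - by case: (dis s' t').
  - by case: (dis t' s').
  - exact: inj (gDE _).1 h1 h2 c.
have ws1 := itv_oo_cc hs1; have ws2 := itv_oo_cc hs2.
have wt1 := itv_oo_cc ht1; have wt2 := itv_oo_cc ht2.
have d1 : det2 (velocity E s1) (velocity E t1) != 0.
  by apply: det2_over; case: ov => -[? ?]; [left|right].
have d2 : det2 (velocity E s2) (velocity E t2) != 0.
  by apply: det2_over; case: ov => -[? ?]; [left|right].
have g := bigon_sgn (abl i0) (abl i1) (gDE i0).2 (gDE i1).2 hs1 hs2 ht1 ht2 ss cr d1 d2.
have tt : t1 != t2.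
  apply: contra_neq ss => tt; apply: (inj E i0) => //; first exact: (gDE i0).2.
  have -> : curve E s1 = curve E t1 by apply/cr => //; left.
  by rewrite tt; apply/esym/cr => //; right.
(* Renaming that puts the over-parameters in [p1], [p2], whichever strand is on top. *)
have [p1 [q1 [p2 [q2 [i [j [pq ij hp hq [np nq gpq]]]]]]]] : exists p1 q1 p2 q2 i j,
    [/\ (p1, q1, p2, q2) = (s1, t1, s2, t2) \/ (p1, q1, p2, q2) = (t1, s1, t2, s2),
      i0 = i /\ i1 = j \/ i0 = j /\ i1 = i,
      a i <= p1 <= b i /\ a i <= p2 <= b i, a j <= q1 <= b j /\ a j <= q2 <= b j
    & [/\ p1 != p2, q1 != q2 & [/\ sgn E p2 q2 = - sgn E p1 q1, over_at E p1 q1 & over_at E p2 q2]]].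
  case: ov => -[ov1 ov2].
    by exists s1, t1, s2, t2, i0, i1; split=> //; left.
  exists t1, s1, t2, s2, i1, i0; split=> //; [by right|by right|split=> //; split=> //].
  by rewrite (sgnC (or_intror ov2)) (sgnC (or_intror ov1)) g.
have [hp1 hp2] := hp; have [hq1 hq2] := hq; have [gs o1 o2] := gpq.
have nij : i != j by case: ij => -[<- <-].
have iE : inventory a b E [:: (p1, q1); (p2, q2)].
  split=> //.
  - rewrite /= andbT inE -pair_eqE /= negb_and; apply/orP; left.
    by apply: contra_neq np => h; apply: frac_same_arc (ab i) hp1 hp2 h.
  - move=> y; rewrite in_cons mem_seq1 => /orP[] /eqP-> /=.
      by split; [exact: o1 | exact: inner_self hp1].
    by split; [exact: o2 | exact: inner_self hp2].
  move=> s t o hi; have [l [m [s' [t' [h1 h2 e1 e2 c]]]]] := window_lift wE o hi.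
  have [/eqP n _] := over_atP o; rewrite -e1 -e2 in n.
  have o' : over_at E s' t' by rewrite (over_at_congr _ e1 e2).
  have lm : l <> m.
    by move=> lm; subst m; apply: n; congr frac; exact: inj (gDE l).2 h1 h2 c.
  have key : (s', t') = (s1, t1) \/ (s', t') = (s2, t2) \/ (s', t') = (t1, s1) \/ (s', t') = (t2, s2).
    case: (ord2P l) (ord2P m) lm h1 h2 => -> [] -> // _ h1 h2.
      by have [[-> ->]|[-> ->]] := (cr _ _ h1 h2).1 c; auto.
    by have [[-> ->]|[-> ->]] := (cr _ _ h2 h1).1 (esym c); auto.
  rewrite /= in_cons mem_seq1 /frac2 /= -e1 -e2; apply/orP.
  have A1 := over_at_asym o1; have A2 := over_at_asym o2.
  case: pq => -[? ? ? ?]; subst p1 q1 p2 q2; case: key => [|[|[|]]] [? ?]; subst s' t';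
    rewrite ?eqxx; auto; by exfalso; auto.
have lr u v : ~~ inner a b u -> ~~ inner a b v ->
    local_rise E [:: (p1, q1); (p2, q2)] u v = local_rise D [::] u v.
  by move=> hu hv; rewrite (local_rise_bigon hp1 hp2 hq1 hq2) // /local_rise big_nil.
have out := manturov_outside iD iE so lr.
have vD s t : over_at (manturov D) s t -> ~~ inner a b s /\ ~~ inner a b t.
  exact: manturov_virtual iD _.
have idx := rise_bigon iE nij hp1 hp2 hq1 hq2 np nq gs.
case: (rr) => abr hc _.
have [ev|od] := eqVneq (rise E p1 q1) (sgn E p1 q1).
  left; exists a, b => /=; rewrite -/i0 -/i1.
  have ev2 : rise E p2 q2 = sgn E p2 q2 by move: idx; rewrite ev subrr => /esym/subr0_eq.
  have ov' : over_at (manturov E) p1 q1 /\ over_at (manturov E) p2 q2.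
    by split; apply/over_at_manturov.
  split; [by split; [exact: wD|exact: wE] | exact: gDE | | exact: dis |].
    split; [exact: abr | exact: hc | move=> s t ns nt].
    (* A pair off the strand [i0] may still lie on [i1]; but every classical crossing in the window
       involves [i0]. *)
    have [si|si] := boolP (inner a b s); last first.
      have [ti|ti] := boolP (inner a b t); last exact: out.
      split=> /over_at_manturov[ov3 _].
        by move: (window_over wE ov3); rewrite (negbTE si) ti.
      by move: (window_over wD ov3); rewrite (negbTE si) ti.
    split=> [/over_at_manturov[ov3 _]|/vD[h _]]; last by rewrite si in h.
    have [_ _ _ hr] := iE; have := hr s t ov3 si.
    rewrite /= in_cons mem_seq1; have na u v : frac u = frac v -> a i0 <= v <= b i0 -> in_arc (a i0) (b i0) u.
      by move=> e h; apply/in_arc_frac; rewrite e; apply/in_arc_frac; exact: in_arc_self.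
    case: pq => -[? ? ? ?]; subst p1 q1 p2 q2; case/orP => /eqP[e1 e2]; exfalso.
    - exact: ns (na _ _ e1 ws1).
    - exact: ns (na _ _ e1 ws2).
    - exact: nt (na _ _ e2 ws1).
    - exact: nt (na _ _ e2 ws2).
  exists s1, s2, t1, t2; split; [exact: ss | by split | exact: cr |].
  by case: pq ov' => -[-> -> -> ->]; [left|right].
right; have vE s t : over_at (manturov E) s t -> ~~ inner a b s /\ ~~ inner a b t.
  apply: (manturov_virtual iE) => y; rewrite in_cons mem_seq1 => /orP[] /eqP-> //=.
  by apply: contra_neq od => e; move: idx; rewrite e subrr => /subr0_eq.
exists (a i0), (b i0); split.
- split; [exact: abr | exact: hc | move=> s t _ _].
  split=> o; first by have [h1 h2] := vE s t o; exact: (out s t h1 h2).1 o.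
  by have [h1 h2] := vD s t o; exact: (out s t h1 h2).2 o.
- by move=> s t /vD[h1 h2]; split; exact: not_inner.
- by move=> s t /vE[h1 h2]; split; exact: not_inner.
Qed.

End FirstSecondMoves.
(** * Third move *)

Section ThirdMove.
Context {R : realType}.
Implicit Types (D E : diagram R) (s t : R) (a b : 'I_3 -> R) (x y : 'I_3 -> 'I_3 -> R)
  (i j k l n : 'I_3).

(** Closed ordinals, so that comparisons between them reduce by computation. *)
Definition o0 : 'I_3 := @Ordinal 3 0 isT.
Definition o1 : 'I_3 := @Ordinal 3 1 isT.
Definition o2 : 'I_3 := @Ordinal 3 2 isT.

Lemma ord3P (i : 'I_3) : [\/ i = o0, i = o1 | i = o2].
Proof.
by case: i => [[|[|[|//]]] h]; [constructor 1|constructor 2|constructor 3]; apply: val_inj.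
Qed.

Lemma ord3_ltP (j k : 'I_3) : (j < k)%N ->
  [\/ (j, k) = (o0, o1), (j, k) = (o0, o2) | (j, k) = (o1, o2)].
Proof.
by case: (ord3P j) => ->; case: (ord3P k) => -> // _; [constructor 1|constructor 2|constructor 3].
Qed.

Definition triangle_crossings x : seq (R * R) :=
  [:: (x o0 o1, x o1 o0); (x o0 o2, x o2 o0); (x o1 o2, x o2 o1)].

Lemma mem_triangle_crossings x (z : R * R) : z \in triangle_crossings x ->
  exists j k : 'I_3, (j < k)%N /\ z = (x j k, x k j).
Proof.
rewrite /triangle_crossings !in_cons in_nil orbF => /or3P[] /eqP->.
- by exists o0, o1.
- by exists o0, o2.
- by exists o1, o2.
Qed.

Lemma triangle_crossings_mem x (j k : 'I_3) : (j < k)%N ->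
  (x j k, x k j) \in triangle_crossings x.
Proof.
rewrite /triangle_crossings !in_cons in_nil orbF.
by case/ord3_ltP => -[-> ->]; rewrite eqxx ?orbT.
Qed.

Lemma ltn_ord_neq (j k : 'I_3) : (j < k)%N -> j != k.
Proof. by move=> jk; apply: contraTneq jk => ->; rewrite ltnn. Qed.

Section Triangle.
Context (a b : 'I_3 -> R) (x : 'I_3 -> 'I_3 -> R) (D : diagram R).
Hypothesis tri : triangle a b x D.

Let win : in_window a b D. Proof. by case: tri. Qed.
Let abl j : a j < b j. Proof. by case: win => /(_ j) /andP[]. Qed.
Let xin j k : j != k -> a j < x j k < b j. Proof. by case: tri => _ _ h _ _; exact: h. Qed.
Let xin' j k : j != k -> a j <= x j k <= b j. Proof. by move=> /xin /itv_oo_cc. Qed.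
Let cross j k : j != k -> curve D (x j k) = curve D (x k j).
Proof.
move=> jk; have kj : k != j by rewrite eq_sym.
by case: tri => _ _ _ h _; apply/(h j k) => //; exact: xin'.
Qed.
Let over j k : (j < k)%N -> over_at D (x j k) (x k j). Proof. by case: tri => _ _ _ _ h; exact: h. Qed.

Lemma triangle_lift s t : over_at D s t -> inner a b s ->
  exists j k : 'I_3, [/\ (j < k)%N, frac (x j k) = frac s & frac (x k j) = frac t].
Proof.
move=> o hi; have [j [k [s' [t' [h1 h2 e1 e2 c]]]]] := window_lift win o hi.
have [/eqP n _] := over_atP o; rewrite -e1 -e2 in n.
have jk : j != k.
  apply/eqP => jk; subst k; apply: n; congr frac.
  have [_ gs _ _ _] := tri; have [e [f g]] := graph_strandP (abl j) (gs j).
  by apply: (graph_inj g h1 h2); rewrite c.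
have [es et] : s' = x j k /\ t' = x k j by case: tri => _ _ _ h _; apply/h.
exists j, k; rewrite -es -et; split=> //.
rewrite ltn_neqAle; have -> /= : (j : nat) != k by [].
rewrite leqNgt; apply/negP => kj; have := over kj; rewrite -es -et.
by apply: over_at_asym; rewrite (over_at_congr _ e1 e2).
Qed.

Lemma triangle_inventory : inventory a b D (triangle_crossings x).
Proof.
split; first exact: win.
- have fn j k l n : j != l -> j != k -> l != n -> frac (x j k) != frac (x l n).
    by move=> jl jk ln; apply: (frac_arc_neq win jl); exact: xin'.
  rewrite /= !in_cons !in_nil !orbF /frac2 -!pair_eqE /=.
  rewrite (negbTE (fn o1 o0 o2 o0 isT isT isT)) (negbTE (fn o0 o1 o1 o2 isT isT isT)).
  by rewrite (negbTE (fn o0 o2 o1 o2 isT isT isT)) andbF.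
- move=> z /mem_triangle_crossings[j [k [jk ->]]]; split; first exact: over.
  exact: inner_self (xin' (ltn_ord_neq jk)).
move=> s t o hi; have [j [k [jk e1 e2]]] := triangle_lift o hi.
apply/mapP; exists (x j k, x k j); first exact: triangle_crossings_mem.
by rewrite /frac2 /= e1 e2.
Qed.

(** Equal parameters would put three strands through one point. *)
Lemma triangle_neq j k l : uniq [:: j; k; l] -> x j k != x j l.
Proof.
rewrite /= !inE negb_or andbT => /andP[/andP[jk jl] kl]; apply/eqP => e.
have kj : k != j by rewrite eq_sym.
have lj : l != j by rewrite eq_sym.
have c1 := cross jk; have c2 := cross jl; rewrite -e in c2.
have [h|h|h] := double_frac (esym c1) c2.
- by have := frac_arc_neq win kj (xin' kj) (xin' jk); rewrite h eqxx.
- by have := frac_arc_neq win jl (xin' jk) (xin' lj); rewrite h eqxx.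
- by have := frac_arc_neq win kl (xin' kj) (xin' lj); rewrite h eqxx.
Qed.

(** Between two strands the floor is a constant of the window, independent of the crossings. The
    index computations thus reduce to the orders on each strand and a few unknown constants. *)
Lemma triangle_floor j k l n : j != k -> l != n ->
  Num.floor (x j k - x l n) =
    if j == l then - (x j k < x l n)%R%:Z else Num.floor (a j - a l).
Proof.
move=> jk ln; case: (eqVneq j l) => [jl|jl].
  subst l; have [ab _ _ _] := win; exact: (floor_same_arc (ab j) (xin' jk) (xin' ln)).
have ai i : a i <= a i <= b i by rewrite lexx ltW.
have n1 : ~ in_arc (a l) (b l) (x j k).
  move=> h; case/negP: jl; apply/eqP.
  exact: (in_arc_uniq win (in_arc_self (xin' jk)) h).
have n2 : ~ in_arc (a j) (b j) (a l).
  move=> h; case/negP: jl; apply/eqP.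
  exact: (in_arc_uniq win h (in_arc_self (ai l))).
rewrite (floor_arc (xin' ln) (ai l) n1).
exact: (floor_arc_r (xin' jk) (ai j) n2).
Qed.

Lemma triangle_sign e f j k z : j != k ->
  graph_of D (a j) (b j) (e j) (f j) -> graph_of D (a k) (b k) (e k) (f k) ->
  -1 <= z <= 1 -> z != (curve D (x j k)).1 ->
  0 < (f k z - f j z) * det2 (velocity D (x j k)) (velocity D (x k j)) * (e j * e k)
      * (z - (curve D (x j k)).1).
Proof.
move=> jk gj gk hz zn; have kj : k != j by rewrite eq_sym.
apply: crossing_sign (abl j) gj gk (xin jk) (xin kj) (cross jk) _ hz zn _.
  apply: det2_over; have : (j : nat) != k by [].
  by rewrite neq_ltn => /orP[] h; [left|right]; exact: over.
move=> u w hu hw c; have [-> _] : u = x j k /\ w = x k j.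
  by case: tri => _ _ _ h _; apply/h.
by move=> /orP[] /andP[h1 h2]; move: h1 h2; rewrite ?ltxx // => h1 h2; rewrite ltxx in h2.
Qed.

Lemma triangle_graphs : exists e f, forall j, graph_of D (a j) (b j) (e j) (f j).
Proof.
have [_ gs _ _ _] := tri.
have /choice[ef h] : forall j, exists p : R * (R -> R), graph_of D (a j) (b j) p.1 p.2.
  by move=> j; have [e [f g]] := graph_strandP (abl j) (gs j); exists (e, f).
by exists (fun j => (ef j).1), (fun j => (ef j).2).
Qed.

Lemma sign_product (k u v z w : R) : 0 < k ^+ 2 * (u * v * (z * w)) ->
  (if 0 < v then 1 else -1 : int) =
  if (0 < z) == (0 < w) then (if 0 < u then 1 else -1) else - (if 0 < u then 1 else -1).
Proof.
move=> p; have q : 0 < u * v * (z * w).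
  by rewrite ltNge; apply/negP => q; move: p; rewrite ltNge mulr_ge0_le0 // sqr_ge0.
have s (c d : R) : c * d != 0 -> (0 < c * d) = ((0 < c) == (0 < d)).
  rewrite mulf_eq0 negb_or => /andP[c0 d0].
  case: (ltgtP 0 c) c0 => // hc _; first by rewrite pmulr_rgt0 //; case: (0 < d).
  by rewrite nmulr_rgt0 //; case: (ltgtP 0 d) d0.
have q0 := lt0r_neq0 q; move: (q); rewrite s //; move: q0; rewrite mulf_eq0 negb_or => /andP[uv zw].
rewrite !s //; case: (0 < u) (0 < v) (0 < z) (0 < w) => [] [] [] [] //.
Qed.

(** On the right is the product of two instances of [triangle_sign] at the abscissa [z1] of the
    crossing of the two upper strands, where both see the same height difference [h] to the third.
    It occurs squared, so it disappears from the sign relation. *)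
Lemma crossing_product1 (h u v c0 c1 c2 z1 z2 z3 : R) :
  (h * c2) ^+ 2 * (u * v * (c0 * (z2 - z1) * (c1 * (z3 - z1)))) =
  h * u * (c0 * c2) * (z1 - z2) * (h * v * (c1 * c2) * (z1 - z3)).
Proof. by ring. Qed.

Lemma crossing_product2 (h1 h0 u v c0 c1 c2 z1 z2 z3 : R) :
  ((h1 - h0) * c1) ^+ 2 * (u * v * (c0 * (z2 - z1) * (c2 * (z3 - z2)))) =
  (h1 - h0) * u * (c0 * c1) * (z2 - z1) * ((h0 - h1) * v * (c1 * c2) * (z2 - z3)).
Proof. by ring. Qed.

(* Compare the heights of the strands over the third crossing. *)
Lemma triangle_sgn12_02 : sgn D (x o1 o2) (x o2 o1) =
  if (x o0 o1 < x o0 o2) == (x o1 o0 < x o1 o2) then sgn D (x o0 o2) (x o2 o0)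
  else - sgn D (x o0 o2) (x o2 o0).
Proof.
have [e [f g]] := triangle_graphs.
rewrite (graph_lt (g o0) (@xin' o0 o1 isT) (@xin' o0 o2 isT)).
rewrite (graph_lt (g o1) (@xin' o1 o0 isT) (@xin' o1 o2 isT)).
have hz := graph_range (abl o0) (g o0) (@xin' o0 o1 isT).
have n1 : (curve D (x o0 o1)).1 != (curve D (x o0 o2)).1.
  apply/eqP => h; have /eqP := @triangle_neq o0 o1 o2 isT; apply.
  exact: graph_inj (g o0) (@xin' o0 o1 isT) (@xin' o0 o2 isT) h.
have n2 : (curve D (x o0 o1)).1 != (curve D (x o1 o2)).1.
  rewrite (@cross o0 o1 isT); apply/eqP => h; have /eqP := @triangle_neq o1 o0 o2 isT; apply.
  exact: graph_inj (g o1) (@xin' o1 o0 isT) (@xin' o1 o2 isT) h.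
have k1 := @triangle_sign e f o0 o2 _ isT (g o0) (g o2) hz n1.
have k2 := @triangle_sign e f o1 o2 _ isT (g o1) (g o2) hz n2.
have e1 : f o0 (curve D (x o0 o1)).1 = f o1 (curve D (x o0 o1)).1.
  rewrite (graph_val (g o0) (@xin' o0 o1 isT)) (@cross o0 o1 isT).
  by rewrite (graph_val (g o1) (@xin' o1 o0 isT)).
rewrite -e1 in k2; rewrite -(@cross o0 o1 isT) !sgnE.
have k3 := mulr_gt0 k1 k2; move: k3; clear k1 k2.
move: (curve D (x o0 o1)).1 (curve D (x o0 o2)).1 (curve D (x o1 o2)).1 => z1 z2 z3.
move: (e o0) (e o1) (e o2) (f o2 z1 - f o0 z1) => c0 c1 c2 h k.
by apply: (@sign_product (h * c2)); rewrite crossing_product1.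
Qed.

(** The same argument over the crossing of the top and bottom strands: there [f o1 - f o0] and
    [f o2 - f o1] are opposite. *)
Lemma triangle_sgn12_01 : sgn D (x o1 o2) (x o2 o1) =
  if (x o0 o1 < x o0 o2) == (x o2 o0 < x o2 o1) then sgn D (x o0 o1) (x o1 o0)
  else - sgn D (x o0 o1) (x o1 o0).
Proof.
have [e [f g]] := triangle_graphs.
rewrite (graph_lt (g o0) (@xin' o0 o1 isT) (@xin' o0 o2 isT)).
rewrite (graph_lt (g o2) (@xin' o2 o0 isT) (@xin' o2 o1 isT)).
have hz := graph_range (abl o0) (g o0) (@xin' o0 o2 isT).
have n1 : (curve D (x o0 o2)).1 != (curve D (x o0 o1)).1.
  apply/eqP => h; have /eqP := @triangle_neq o0 o2 o1 isT; apply.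
  exact: graph_inj (g o0) (@xin' o0 o2 isT) (@xin' o0 o1 isT) h.
have n2 : (curve D (x o0 o2)).1 != (curve D (x o1 o2)).1.
  rewrite (@cross o0 o2 isT) (@cross o1 o2 isT).
  apply/eqP => h; have /eqP := @triangle_neq o2 o0 o1 isT; apply.
  exact: graph_inj (g o2) (@xin' o2 o0 isT) (@xin' o2 o1 isT) h.
have k1 := @triangle_sign e f o0 o1 _ isT (g o0) (g o1) hz n1.
have k2 := @triangle_sign e f o1 o2 _ isT (g o1) (g o2) hz n2.
have e1 : f o2 (curve D (x o0 o2)).1 = f o0 (curve D (x o0 o2)).1.
  rewrite (graph_val (g o0) (@xin' o0 o2 isT)) (@cross o0 o2 isT).
  by rewrite (graph_val (g o2) (@xin' o2 o0 isT)).
rewrite e1 in k2; rewrite -(@cross o0 o2 isT) -(@cross o1 o2 isT) !sgnE.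
have k3 := mulr_gt0 k1 k2; move: k3; clear k1 k2.
move: (curve D (x o0 o1)).1 (curve D (x o0 o2)).1 (curve D (x o1 o2)).1 => z1 z2 z3.
move: (e o0) (e o1) (e o2) (f o1 z2) (f o0 z2) => c0 c1 c2 h1 h0 k.
by apply: (@sign_product ((h1 - h0) * c1)); rewrite crossing_product2.
Qed.

(* Go from x o0 o2 to x o2 o0 through the two other crossings of the triangle. *)
Lemma triangle_index :
  rise D (x o0 o2) (x o2 o0) - sgn D (x o0 o2) (x o2 o0) =
  (rise D (x o0 o1) (x o1 o0) - sgn D (x o0 o1) (x o1 o0)) +
  (rise D (x o1 o2) (x o2 o1) - sgn D (x o1 o2) (x o2 o1)).
Proof.
rewrite (rise_trans D _ (x o0 o1)) (rise_trans D (x o0 o1) (x o1 o0) (x o2 o0)).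
rewrite (rise_trans D (x o1 o0) (x o1 o2) (x o2 o0)) (rise_trans D (x o1 o2) (x o2 o1) (x o2 o0)).
rewrite (rise_strand triangle_inventory (@xin' o0 o2 isT) (@xin' o0 o1 isT)).
rewrite (rise_strand triangle_inventory (@xin' o1 o0 isT) (@xin' o1 o2 isT)).
rewrite (rise_strand triangle_inventory (@xin' o2 o1 isT) (@xin' o2 o0 isT)).
rewrite /local_rise !big_cons !big_nil /= /cnt !triangle_floor //= !ltxx.
have := triangle_sgn12_02; have := triangle_sgn12_01.
have := @triangle_neq o0 o1 o2 isT; have := @triangle_neq o1 o0 o2 isT.
have := @triangle_neq o2 o0 o1 isT.
move: (sgn D _ _) (sgn D _ _) (sgn D _ _) (rise D _ _) (rise D _ _) => s1 s2 s3 r1 r2.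
case: (ltgtP (x o0 o1) (x o0 o2)) => // _; case: (ltgtP (x o1 o0) (x o1 o2)) => // _;
  case: (ltgtP (x o2 o0) (x o2 o1)) => //= _ _ _ _ -> e; move: e; clear; lia.
Qed.

End Triangle.

Lemma triangle_unique a b x x' D j k : triangle a b x D -> triangle a b x' D ->
  j != k -> x' j k = x j k.
Proof.
move=> [_ _ h1 h2 _] [_ _ h1' h2' _] jk; have kj : k != j by rewrite eq_sym.
have c : curve D (x' j k) = curve D (x' k j).
  by apply/(h2' j k) => //; apply: itv_oo_cc; exact: h1'.
have [-> _] // : x' j k = x j k /\ x' k j = x k j.
by apply/(h2 j k) => //; apply: itv_oo_cc; exact: h1'.
Qed.

Lemma same_signs (h u v c z w : R) : 0 < h * u * c * z -> 0 < h * v * c * w ->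
  0 < z -> 0 < w -> (if 0 < v then 1 else -1 : int) = if 0 < u then 1 else -1.
Proof.
move=> p q z0 w0; rewrite pmulr_lgt0 // in p; rewrite pmulr_lgt0 // in q.
have : 0 < (h * c) ^+ 2 * (u * v * (1 * 1)).
  by have := mulr_gt0 p q; congr (0 < _); ring.
by move/sign_product => ->; rewrite ltr01.
Qed.

Lemma right_end : -1 <= (1 : R) <= 1.
Proof. by lra. Qed.

Section Slide.
Context (a b : 'I_3 -> R) (i : 'I_3) (D E : diagram R) (x y : 'I_3 -> 'I_3 -> R).
Hypotheses (triD : triangle a b x D) (triE : triangle a b y E).
Hypothesis rr : reroute (a i) (b i) D E.
Hypothesis swap : forall j k l, uniq [:: j; k; l] -> (x j k < x j l <-> y j l < y j k).

Let winD : in_window a b D. Proof. by case: triD. Qed.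
Let winE : in_window a b E. Proof. by case: triE. Qed.
Let abl j : a j < b j. Proof. by case: winD => /(_ j) /andP[]. Qed.
Let xin j k : j != k -> a j <= x j k <= b j.
Proof. by case: triD => _ _ h _ _ jk; apply: itv_oo_cc; exact: h. Qed.
Let yin j k : j != k -> a j <= y j k <= b j.
Proof. by case: triE => _ _ h _ _ jk; apply: itv_oo_cc; exact: h. Qed.

Lemma slide_ends j : curve E (a j) = curve D (a j) /\ curve E (b j) = curve D (b j).
Proof.
have [->|ji] := eqVneq j i; first by split; [exact: reroute_left rr | exact: reroute_right rr].
have [_ hc _] := rr; have nin t : a j <= t <= b j -> ~ in_arc (a i) (b i) t.
  by move=> ht h; case/negP: ji; apply/eqP; exact: (in_arc_uniq winD (in_arc_self ht) h).
by split; apply: hc; apply: nin; rewrite lexx ltW.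
Qed.

(** Two graphs that cross once have a crossing sign determined by their directions and by their
    heights at the right edge, [x = 1]. A slide changes neither. *)
Lemma slide_sgn j k : j != k -> sgn E (y j k) (y k j) = sgn D (x j k) (x k j).
Proof.
move=> jk; have [e [f g]] := triangle_graphs triD; have [e' [f' g']] := triangle_graphs triE.
have ee l : e' l = e l.
  have [h1 _] := graph_ends (g l); have [h2 _] := graph_ends (g' l).
  by apply: oppr_inj; rewrite -h1 -h2 (slide_ends l).1.
have ff l : f' l 1 = f l 1.
  rewrite (graph_end (abl l) (g l)) (graph_end (abl l) (g' l)) ee.
  by case: ifP => _; [rewrite (slide_ends l).2 | rewrite (slide_ends l).1].
(* Crossings are interior to their strands, hence strictly to the left of the edge. *)
have lt1 F x' e'' f'' : triangle a b x' F -> graph_of F (a j) (b j) e'' f'' -> 0 < 1 - (curve F (x' j k)).1.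
  move=> tri gF; have [_ _ h _ _] := tri; have hx := h j k jk; have hx' := itv_oo_cc hx.
  have /andP[_ r1] := graph_range (abl j) gF hx'.
  rewrite subr_gt0 lt_neqAle r1 andbT; apply/eqP => x1.
  have [ea eb] := graph_ends gF; case/andP: hx => ha hb.
  case: (graph_dir gF) => e1.
    have : x' j k = b j by apply: (graph_inj gF hx'); rewrite ?lexx ?ltW // x1 eb e1.
    by move=> e2; rewrite e2 ltxx in hb.
  have : x' j k = a j by apply: (graph_inj gF hx'); rewrite ?lexx ?ltW // x1 ea e1 opprK.
  by move=> e2; rewrite e2 ltxx in ha.
have p1 := lt1 D x _ _ triD (g j); have p2 := lt1 E y _ _ triE (g' j).
have h1 := right_end.
have n1 : 1 != (curve D (x j k)).1 by move: p1; rewrite subr_gt0 => /gt_eqF ->.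
have n2 : 1 != (curve E (y j k)).1 by move: p2; rewrite subr_gt0 => /gt_eqF ->.
have k1 := triangle_sign triD jk (g j) (g k) h1 n1.
have k2 := triangle_sign triE jk (g' j) (g' k) h1 n2.
rewrite !ff !ee in k2; rewrite !sgnE; exact: same_signs k1 k2 p1 p2.
Qed.

Let swapb j k l : uniq [:: j; k; l] -> (y j k < y j l) = ~~ (x j k < x j l).
Proof.
move=> u; have u' : uniq [:: j; l; k].
  by move: u; rewrite /= !inE !negb_or !andbT (eq_sym k l) => /andP[/andP[-> ->] ->].
have := triangle_neq triD u; have : (y j k < y j l) = (x j l < x j k).
  by apply/idP/idP => [/(swap u').2|/(swap u').1].
by move=> ->; case: ltgtP.
Qed.

Let same : same_outside a b D E. Proof. exact: reroute_same_outside rr. Qed.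
Let invD := triangle_inventory triD.
Let invE := triangle_inventory triE.

(** The outer contribution is unchanged. Inside, the crossing with the third strand changes side at
    both ends of the path from [x j k] to [x k j], and the sign relations of the triangle make the
    two changes cancel. *)
Lemma slide_index j k : (j < k)%N ->
  rise E (y j k) (y k j) - sgn E (y j k) (y k j) = rise D (x j k) (x k j) - sgn D (x j k) (x k j).
Proof.
move=> jk; have njk := ltn_ord_neq jk; have nkj : k != j by rewrite eq_sym.
rewrite slide_sgn //; congr (_ - _); rewrite (rise_inventory _ _ invD) (rise_inventory _ _ invE).
rewrite (outer_rise_eq _ _ winD winE same).
rewrite (outer_rise_strand winD (yin njk) (xin njk) (yin nkj) (xin nkj)); congr (_ + _).
have s12_02 := triangle_sgn12_02 triD; have s12_01 := triangle_sgn12_01 triD.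
rewrite /local_rise /triangle_crossings !big_cons !big_nil /= !slide_sgn // /cnt.
move: s12_02 s12_01.
have t1 := @triangle_neq _ _ _ _ triD o0 o1 o2 isT.
have t2 := @triangle_neq _ _ _ _ triD o1 o0 o2 isT.
have t3 := @triangle_neq _ _ _ _ triD o2 o0 o1 isT.
move: (sgn D _ _) (sgn D _ _) (sgn D _ _) => s1 s2 s3.
case/ord3_ltP: jk => -[? ?]; subst j k;
  rewrite !(triangle_floor triD) // !(triangle_floor triE) //= !ltxx !swapb //;
  move: t1 t2 t3; case: (ltgtP (x o0 o1) (x o0 o2)) => // _ _;
  case: (ltgtP (x o1 o0) (x o1 o2)) => // _ _; case: (ltgtP (x o2 o0) (x o2 o1)) => //= _ _ -> e;
  move: e; move: (Num.floor _) (Num.floor _) (Num.floor _) (Num.floor _); clear; lia.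
Qed.

Lemma local_rise_triangle s t : ~~ inner a b s -> ~~ inner a b t ->
  local_rise E (triangle_crossings y) s t = local_rise D (triangle_crossings x) s t.
Proof.
move=> hs ht; rewrite /local_rise /triangle_crossings !big_cons !big_nil /= !slide_sgn //.
have c j k : j != k -> cnt (y j k) s t = cnt (x j k) s t.
  move=> jk; rewrite /cnt (floor_arc (yin jk) (xin jk) (not_inner hs)).
  by rewrite (floor_arc (yin jk) (xin jk) (not_inner ht)).
by rewrite !c.
Qed.

Lemma slide_outside s t : ~~ inner a b s -> ~~ inner a b t ->
  (over_at (manturov E) s t <-> over_at (manturov D) s t).
Proof. exact: (manturov_outside invD invE same local_rise_triangle). Qed.

End Slide.

(** A crossing present in both diagrams at the same parameters joins the same two strands in both,
    because distinct strands share no parameter. It is thus the crossing of the same pair [j], [k]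
    in each triangle, to which the parity hypothesis applies. *)
Lemma manturov_inner_transfer a b x y D E s t : triangle a b x D -> triangle a b y E ->
  (forall j k, (j < k)%N -> rise D (x j k) (x k j) = sgn D (x j k) (x k j) ->
     rise E (y j k) (y k j) = sgn E (y j k) (y k j)) ->
  (over_at D s t -> over_at E s t) -> inner a b s ->
  over_at (manturov D) s t -> over_at (manturov E) s t.
Proof.
move=> triD triE ev ov si /over_at_manturov[h e].
have [j [k [jk e1 e2]]] := triangle_lift triD h si.
have hE := ov h; have [j' [k' [jk' e1' e2']]] := triangle_lift triE hE si.
have [winD _ xin _ _] := triD; have [_ _ yin _ _] := triE.
have arc l m l' m' : l != m -> l' != m' -> frac (x l m) = frac (y l' m') -> l = l'.
  move=> lm lm' ex; apply/eqP/negPn/negP => n.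
  have := frac_arc_neq winD n (itv_oo_cc (xin l m lm)) (itv_oo_cc (yin l' m' lm')).
  by rewrite ex eqxx.
have nk := ltn_ord_neq jk; have nk' := ltn_ord_neq jk'.
have jj : j = j' by apply: (arc j k j' k') => //; rewrite e1 e1'.
have kk : k = k' by apply: (arc k j k' j'); rewrite 1?eq_sym // e2 e2'.
subst j' k'; apply/over_at_manturov; split; first exact: hE.
rewrite -(rise_congr E e1' e2') -(sgn_congr E e1' e2'); apply: ev => //.
by rewrite (rise_congr D e1 e2) (sgn_congr D e1 e2).
Qed.

Lemma slide_over a b i D E : slide a b i D E ->
  forall s t, ~ in_arc (a i) (b i) s -> ~ in_arc (a i) (b i) t ->
    (over_at (manturov E) s t <-> over_at (manturov D) s t).
Proof.
move=> [x [y [triD triE rr swap]]] s t ns nt.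
have [winD _ _ _ _] := triD; have [winE _ _ _ _] := triE.
have [_ _ ho] := rr; have hst := ho s t ns nt.
have idx := slide_index triD triE rr swap.
have [si|si] := boolP (inner a b s); last first.
  have [ti|ti] := boolP (inner a b t); last exact: (slide_outside triD triE rr si ti).
  split=> /over_at_manturov[h _].
    by move: (window_over winE h); rewrite (negbTE si) ti.
  by move: (window_over winD h); rewrite (negbTE si) ti.
split.
  apply: (manturov_inner_transfer triE triD) => //; last exact: hst.1.
  by move=> j k jk e; have := idx j k jk; rewrite e subrr => /esym/subr0_eq.
apply: (manturov_inner_transfer triD triE) => //; last exact: hst.2.
by move=> j k jk e; have := idx j k jk; rewrite e subrr => /subr0_eq.
Qed.

(** The crossings are even before the slide, hence after it by [slide_index], and both triangles
    survive the projection. *)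
Lemma slide_even a b i x D E : triangle a b x D ->
  (forall j k, (j < k)%N -> rise D (x j k) (x k j) = sgn D (x j k) (x k j)) ->
  slide a b i D E -> slide a b i (manturov D) (manturov E).
Proof.
move=> tri0 ev sl; have sov := slide_over sl; move: sl => [x' [y [triD triE rr swap]]].
have idx := slide_index triD triE rr swap.
have evD j k : (j < k)%N -> rise D (x' j k) (x' k j) = sgn D (x' j k) (x' k j).
  move=> jk; have njk := ltn_ord_neq jk; have nkj : k != j by rewrite eq_sym.
  by rewrite (triangle_unique tri0 triD njk) (triangle_unique tri0 triD nkj); exact: ev.
have evE j k : (j < k)%N -> rise E (y j k) (y k j) = sgn E (y j k) (y k j).
  by move=> jk; have := idx j k jk; rewrite evD // subrr => /subr0_eq.
exists x', y; split; last exact: swap.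
- case: triD => h1 h2 h3 h4 h5; split; [exact: h1|exact: h2|exact: h3|exact: h4|].
  by move=> j k jk; apply/over_at_manturov; split; [exact: h5 | exact: evD].
- case: triE => h1 h2 h3 h4 h5; split; [exact: h1|exact: h2|exact: h3|exact: h4|].
  by move=> j k jk; apply/over_at_manturov; split; [exact: h5 | exact: evE].
- by case: rr => h1 h2 _; split; [exact: h1 | exact: h2 | exact: sov].
Qed.

Lemma triangle_virtual a b x D i : triangle a b x D ->
  (forall j k, (j < k)%N -> (j == i) || (k == i) -> rise D (x j k) (x k j) <> sgn D (x j k) (x k j)) ->
  all_virtual (a i) (b i) (manturov D).
Proof.
move=> tri odd s t /over_at_manturov[h e].
have [win _ xin _ _] := tri.
have main : ~ (in_arc (a i) (b i) s \/ in_arc (a i) (b i) t).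
  move=> st; have si : inner a b s.
    case: st => st; first by apply/innerP; exists i.
    by rewrite (window_over win h); apply/innerP; exists i.
  have [j [k [jk e1 e2]]] := triangle_lift tri h si; have njk := ltn_ord_neq jk.
  apply: (odd j k jk); last by rewrite (rise_congr D e1 e2) (sgn_congr D e1 e2).
  have inx l m u : l != m -> frac (x l m) = frac u -> in_arc (a i) (b i) u -> l == i.
    move=> lm ex hu; apply/eqP.
    apply: (in_arc_uniq win (in_arc_self (itv_oo_cc (xin l m lm)))).
    by apply/in_arc_frac; rewrite ex; apply/in_arc_frac.
  case: st => st; first by rewrite (inx j k s).
  by rewrite (inx k j t) ?orbT // eq_sym.
by split=> hh; apply: main; [left|right].
Qed.

(** Both crossings on strand [i] become virtual before and after the slide; the crossing of the two
    fixed strands may have either parity. *)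
Lemma slide_odd a b i x D E : triangle a b x D ->
  (forall j k, (j < k)%N -> (j == i) || (k == i) -> rise D (x j k) (x k j) <> sgn D (x j k) (x k j)) ->
  slide a b i D E -> detour (manturov D) (manturov E).
Proof.
move=> tri0 odd sl; have sov := slide_over sl; move: sl => [x' [y [triD triE rr swap]]].
have idx := slide_index triD triE rr swap.
exists (a i), (b i); split.
- by case: rr => h1 h2 _; split; [exact: h1 | exact: h2 | exact: sov].
- exact: triangle_virtual tri0 odd.
apply: (triangle_virtual triE) => j k jk hi e.
have njk := ltn_ord_neq jk; have nkj : k != j by rewrite eq_sym.
apply: (odd j k jk hi); have := idx j k jk; rewrite e subrr => /esym/subr0_eq.
by rewrite (triangle_unique tri0 triD njk) (triangle_unique tri0 triD nkj).
Qed.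

Lemma two_even (r0 s0 r1 s1 r2 s2 : int) : r0 - s0 = (r1 - s1) + (r2 - s2) ->
  [/\ r1 = s1 -> r2 = s2 -> r0 = s0, r1 = s1 -> r0 = s0 -> r2 = s2
    & r2 = s2 -> r0 = s0 -> r1 = s1].
Proof. by move=> e; split; lia. Qed.

Lemma reidemeister3_manturov D E : reidemeister3 D E ->
  same_virtual_knot (manturov D) (manturov E).
Proof.
(* [x] is extracted from the slide of strand 0, but it is determined by [D] ([triangle_unique]), so
   it serves for all three slides. *)
move=> [a [b H]]; have [D0 [x [y [tri _ _ _]]] _] := H o0.
have [ix02 ix12 ix01] := two_even (triangle_index tri).
pose ev j k := rise D (x j k) (x k j) = sgn D (x j k) (x k j).
have odd i : (forall j k, (j < k)%N -> (j == i) || (k == i) -> ~ ev j k) ->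
    same_virtual_knot (manturov D) (manturov E).
  move=> h; have [F sl iso] := H i; apply: (@SvkTrans _ _ (manturov F)).
    by apply: SvkDetour; exact: slide_odd tri h sl.
  by apply: SvkIsotopy; exact: planar_isotopy_manturov.
have [e01|e01] := pselect (ev o0 o1); have [e12|e12] := pselect (ev o1 o2).
- have e02 : ev o0 o2 := ix02 e01 e12.
  apply: SvkR3; exists a, b => i; have [F sl iso] := H i.
  exists (manturov F); last exact: planar_isotopy_manturov.
  by apply: slide_even tri _ sl => j k /ord3_ltP[] [-> ->].
(* With 01 even and 12 odd, 02 must be odd: the two odd crossings meet on strand 2. The next case is
   symmetric. *)
- apply: (odd o2) => j k /ord3_ltP[] [-> ->] // _ e; apply: e12; exact: ix12 e01 e.
- apply: (odd o0) => j k /ord3_ltP[] [-> ->] // _ e; apply: e01; exact: ix01 e12 e.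
(* Here 01 and 12 are odd and share strand 1; 02 does not lie on it. *)
- by apply: (odd o1) => j k /ord3_ltP[] [-> ->].
Qed.

End ThirdMove.

(** * Projection of equivalences and stability *)

Lemma same_virtual_knot_manturov (R : realType) (D E : diagram R) :
  same_virtual_knot D E -> same_virtual_knot (manturov D) (manturov E).
Proof.
elim=> {D E} [D E h|D E h|D E h|D E h|D E h|D|D E _ h|D E F _ h1 _ h2].
- by apply: SvkIsotopy; exact: planar_isotopy_manturov.
- by apply: SvkR1; exact: reidemeister1_manturov.
- by have [h'|h'] := reidemeister2_manturov h; [exact: SvkR2 | exact: SvkDetour].
- exact: reidemeister3_manturov.
- by apply: SvkDetour; exact: detour_manturov.
- exact: SvkRefl.
- exact: SvkSym.
- exact: SvkTrans h1 h2.
Qed.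

Theorem theorem3p8 (R : realType) (q : nat) (K : diagram R) :
  (2 <= q)%N ->
  q_periodic q K ->
  represents_almost_classical_knot K ->
  [/\ q_periodic q (stable_manturov K),
      almost_classical (stable_manturov K)
    & same_virtual_knot (stable_manturov K) K].
Proof.
move=> _ qK [A aA KA].
have fixA : manturov A = A by apply: manturov_id; exact: almost_classical_even.
split.
- rewrite /stable_manturov; elim: (projT1 _) => [//|n IH].
  exact: q_periodic_manturov.
- by apply: even_almost_classical => s t; exact: stable_manturov_even.
apply: SvkTrans (SvkSym KA); rewrite /stable_manturov; elim: (projT1 _) => [//|n IH].
by rewrite iterS -[X in same_virtual_knot _ X]fixA; exact: same_virtual_knot_manturov.
Qed.
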